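(* Let $G=(V,E)$ be a connected, locally finite graph with vertex weight $\mu:V\to(0,\infty)$ satisfying $\mu(x)\ge \mu_{\min}>0$ for all $x\in V$. Assume that $a,b:V\to\mathbb R$ satisfy: (A1) there is a constant $V_0>0$ with $a(x)\ge V_0$ and $b(x)\ge V_0$ for all $x\in V$; (A2) for every $\mathcal M>0$ the sets $D^a_{\mathcal M}=\{x\in V: a(x)\le \mathcal M\}$ and $D^b_{\mathcal M}=\{x\in V: b(x)\le \mathcal M\}$ have finite volume, i.e. $\sum_{x\in D^a_{\mathcal M}}\mu(x)<\infty$ and $\sum_{x\in D^b_{\mathcal M}}\mu(x)<\infty$. Then for every $p>4$ the system $$\begin{cases}-\Delta_p u+a(x)|u|^{p-2}u=\frac{p-2}{p}|u|^{p-4}u\,v^2\log v^2+\frac2p|v|^{p-2}u\log u^2+\frac2p|v|^{p-2}u,\\ -\Delta_p v+b(x)|v|^{p-2}v=\frac{p-2}{p}|v|^{p-4}v\,u^2\log u^2+\frac2p|u|^{p-2}v\log v^2+\frac2p|u|^{p-2}v,\end{cases}\quad\text{on }V,$$ admits a ground state solution.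
   Context: Notation. $x\sim y$ means $(x,y)\in E$; $\int_V f\,d\mu=\sum_{x\in V}f(x)\mu(x)$; $C_c(V)$ is the space of finitely supported real functions on $V$. $\Gamma(u,v)(x)=\frac1{2\mu(x)}\sum_{y\sim x}(u(y)-u(x))(v(y)-v(x))$, $\nabla u\nabla v:=\Gamma(u,v)$, $|\nabla u|(x)=\sqrt{\Gamma(u,u)(x)}$, and $$\Delta_pu(x)=\frac1{2\mu(x)}\sum_{y\sim x}\big(|\nabla u|^{p-2}(y)+|\nabla u|^{p-2}(x)\big)(u(y)-u(x)).$$ $W^{1,p}(V)$ is the completion of $C_c(V)$ under $\|u\|_{W^{1,p}}=(\int_V(|\nabla u|^p+|u|^p)d\mu)^{1/p}$. $\mathcal H_a=\{u\in W^{1,p}(V):\int_Va|u|^pd\mu<\infty\}$ with norm $\|u\|_{\mathcal H_a}=(\int_V(|\nabla u|^p+a|u|^p)d\mu)^{1/p}$, $\mathcal H_b$ likewise with $b$, and $\mathcal H=\mathcal H_a\times\mathcal H_b$ with norm $\|(u,v)\|_{\mathcal H}=\|u\|_{\mathcal H_a}+\|v\|_{\mathcal H_b}$. Expressions such as $s\log s^2$ and $s^2\log s^2$ are $0$ at $s=0$. The energy is $$J(u,v)=\tfrac1p\big(\|u\|_{\mathcal H_a}^p+\|v\|_{\mathcal H_b}^p\big)-\tfrac1p\int_V|u|^{p-2}v^2\log v^2\,d\mu-\tfrac1p\int_V|v|^{p-2}u^2\log u^2\,d\mu,$$ with finite domain $\mathcal D(J)=\{(u,v)\in\mathcal H:|J(u,v)|<\infty\}$.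 For $(u,v),(\xi,\eta)\in\mathcal D(J)$ set $$\begin{aligned}J'(u,v)\cdot(\xi,\eta)&=\int_V\big(|\nabla u|^{p-2}\nabla u\nabla\xi+|\nabla v|^{p-2}\nabla v\nabla\eta+a|u|^{p-2}u\xi+b|v|^{p-2}v\eta\big)d\mu\\&\quad-\tfrac{p-2}p\int_V|u|^{p-4}u\xi v^2\log v^2d\mu-\tfrac2p\int_V|u|^{p-2}\eta(v\log v^2+v)d\mu\\&\quad-\tfrac{p-2}p\int_V|v|^{p-4}v\eta u^2\log u^2d\mu-\tfrac2p\int_V|v|^{p-2}\xi(u\log u^2+u)d\mu.\end{aligned}$$ The Nehari manifold is $\mathcal N=\{(u,v)\in\mathcal D(J)\setminus\{(0,0)\}:J'(u,v)\cdot(u,v)=0\}$ and $d=\inf_{\mathcal N}J$. A ground state solution of the system is a pair $(u_0,v_0)\in\mathcal N$ with $J(u_0,v_0)=d$. *)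

(* Defs.v *)
From mathcomp Require Import all_boot all_order all_algebra.
From mathcomp Require Import all_classical all_reals all_analysis.

Set Implicit Arguments.
Unset Strict Implicit.
Unset Printing Implicit Defensive.

Import Order.TTheory GRing.Theory Num.Theory.
Import numFieldNormedType.Exports.

Local Open Scope classical_set_scope.
Local Open Scope ring_scope.

(* A graph on [V] is given by its symmetric adjacency relation [e]. Loops are
   not excluded; they contribute 0 to every sum over neighbours below. *)
Definition locally_finite (V : choiceType) (e : rel V) : Prop :=
  forall x, finite_set [set y | e x y].

Definition connected_graph (V : choiceType) (e : rel V) : Prop :=
  (exists x : V, True) /\
  forall x y : V, exists s : seq V, path e x s /\ last x s = y.

Section LogarithmicSystem.
Variables (R : realType) (V : choiceType) (e : rel V) (mu : V -> R).

Definition volume (D : set V) : \bar R := (\esum_(x in D) (mu x)%:E)%E.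

(* Integral of a signed function, with values in [\bar R], as the difference of
   the sums of its positive and negative parts (the Lebesgue integral for the
   measure with atoms [mu x]). If both parts diverge, its value is the one of
   [+oo - +oo] in [\bar R], namely [-oo]. *)
Definition gint (f : V -> R) : \bar R :=
  (\esum_(x in [set: V]) (f^\+%R x * mu x)%:E -
   \esum_(x in [set: V]) (f^\-%R x * mu x)%:E)%E.

Definition Gamma (u v : V -> R) (x : V) : R :=
  (2 * mu x)^-1 * \sum_(y \in [set y | e x y]) ((u y - u x) * (v y - v x)).

Definition gradn (u : V -> R) (x : V) : R := Num.sqrt (Gamma u u x).

Definition Cc : set (V -> R) := [set u | finite_set [set x | u x != 0]].

Variable p : R.

Definition normW (u : V -> R) : \bar R :=
  (gint (fun x => gradn u x `^ p + `|u x| `^ p)%R `^ p^-1)%E.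

(* The completion of [Cc] for [normW], realized as a space of functions: when
   [mu] is bounded below by a positive constant, [normW] controls every point
   evaluation, the functions with finite [normW] form a Banach space, and the
   completion is the closure of [Cc] therein. *)
Definition W1p : set (V -> R) :=
  [set u | forall eps : R, 0 < eps ->
    exists2 phi, Cc phi & (normW (fun x => u x - phi x)%R < eps%:E)%E].

Definition Hspace (c : V -> R) : set (V -> R) :=
  [set u | W1p u /\ (gint (fun x => c x * `|u x| `^ p)%R < +oo)%E].

Definition normH (c u : V -> R) : \bar R :=
  (gint (fun x => gradn u x `^ p + c x * `|u x| `^ p)%R `^ p^-1)%E.

Variables a b : V -> R.

(* [ln 0 = 0] in the library, so [s * ln (s ^+ 2)] and [s ^+ 2 * ln (s ^+ 2)]
   vanish at [s = 0]. On [Hspace a `*` Hspace b] the two logarithmic integrals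
   have summable positive parts, so that no [+oo - +oo] occurs in [J]. *)
Definition J (w : (V -> R) * (V -> R)) : \bar R :=
  let: (u, v) := w in
  ((p^-1)%:E * (normH a u `^ p + normH b v `^ p)
   - (p^-1)%:E *
     gint (fun x => `|u x| `^ (p - 2) * (v x ^+ 2 * ln (v x ^+ 2)))%R
   - (p^-1)%:E *
     gint (fun x => `|v x| `^ (p - 2) * (u x ^+ 2 * ln (u x ^+ 2)))%R)%E.

Definition domJ : set ((V -> R) * (V -> R)) :=
  [set w | Hspace a w.1 /\ Hspace b w.2 /\ (`|J w| < +oo)%E].

(* The formal derivative of [J] at [w] in the direction [z]. For [w] in [domJ],
   all the integrals in [J' w w] converge absolutely. *)
Definition J' (w z : (V -> R) * (V -> R)) : \bar R :=
  let: (u, v) := w in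
  let: (xi, eta) := z in
  (gint (fun x => gradn u x `^ (p - 2) * Gamma u xi x
                  + gradn v x `^ (p - 2) * Gamma v eta x
                  + a x * `|u x| `^ (p - 2) * u x * xi x
                  + b x * `|v x| `^ (p - 2) * v x * eta x)%R
   - ((p - 2) / p)%:E *
     gint (fun x => `|u x| `^ (p - 4) * u x * xi x
                    * (v x ^+ 2 * ln (v x ^+ 2)))%R
   - (2 / p)%:E *
     gint (fun x => `|u x| `^ (p - 2) * eta x
                    * (v x * ln (v x ^+ 2) + v x))%R
   - ((p - 2) / p)%:E *
     gint (fun x => `|v x| `^ (p - 4) * v x * eta x
                    * (u x ^+ 2 * ln (u x ^+ 2)))%R
   - (2 / p)%:E *
     gint (fun x => `|v x| `^ (p - 2) * xi x
                    * (u x * ln (u x ^+ 2) + u x))%R)%E.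

Definition nehari : set ((V -> R) * (V -> R)) :=
  [set w | domJ w /\ w <> (cst 0, cst 0) /\ J' w w = 0%E].

Definition ground_level : \bar R := ereal_inf [set J w | w in nehari].

Definition ground_state (w : (V -> R) * (V -> R)) : Prop :=
  nehari w /\ J w = ground_level.

End LogarithmicSystem.

(* Main.v *)
Require Import Defs.
From HB Require Import structures.
From mathcomp Require Import all_boot all_order all_algebra finmap.
From mathcomp Require Import all_classical all_reals all_analysis.
From mathcomp Require Import ring lra.

Set Implicit Arguments.
Unset Strict Implicit.
Unset Printing Implicit Defensive.

Import Order.TTheory GRing.Theory Num.Theory.
Import numFieldNormedType.Exports.

Local Open Scope classical_set_scope.
Local Open Scope ring_scope.

(** Let [EN] be the sum of the [p]-th powers of the norms of [u] and [v], [EK] the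
    integral of [|u|^(p-2) v^2 + |v|^(p-2) u^2] and [EL] the same integral with the
    logarithms. On the Nehari manifold [EN = EL + (2/p) EK] and [J = (2/p^2) EK], and
    every admissible pair [w] with [EK w > 0] has exactly one positive multiple [t w]
    on the manifold, with [t <= 1] iff [EN w <= EL w + (2/p) EK w].
    Bounding the logarithms by their value at the largest entry gives
    [c s <= (2/p) EK (ln s + 1)] with [EN = c s], so on the manifold [EK] is bounded
    away from 0 and [EN] is controlled by [EK]. Take a sequence minimizing [EK] and its
    pointwise limit [w] along an ultrafilter. As the sublevel sets of [a] and [b] are
    finite, Fatou's lemma and its reverse give [0 < EK w <= inf EK] and
    [EN w <= EL w + (2/p) EK w], hence [t w] is a minimizer. That [w] stays in the
    closure of the finitely supported functions follows from Clarkson's inequality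
    applied to finitely supported functions that are pointwise close to [w]. *)

Lemma cvg_fsum {R : realType} {T : Type} {F : set_system T} {FF : Filter F}
    {V : choiceType} (A : set V) (f_ : T -> V -> R) (f : V -> R) :
  finite_set A -> (forall x, f_ i x @[i --> F] --> f x) ->
  (\sum_(x \in A) f_ i x) @[i --> F] --> \sum_(x \in A) f x.
Proof.
move=> finA cf.
have E g : \sum_(x \in A) g x = \sum_(x <- finmap.enum_fset (fset_set A)) g x :> R.
  exact: fsbig_finite.
rewrite E; under eq_fun do rewrite E.
elim: (finmap.enum_fset _) => [|x s IH].
  by rewrite big_nil; under eq_fun do rewrite big_nil; exact: cvg_cst.
rewrite big_cons (_ : (fun i => _) = fun i => f_ i x + \sum_(y <- s) f_ i y).
  by apply: cvgD => //; exact: cf.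
by apply/funext => i; rewrite big_cons.
Qed.

(** * Weighted sums *)

Section WeightedSums.
Variables (R : realType) (V : choiceType) (mu : V -> R).
Hypothesis mu_ge0 : forall x, 0 <= mu x.
Implicit Types (f g h : V -> R) (A : set V).

Definition L1 f : Prop := (\esum_(x in [set: V]) (`|f x| * mu x)%:E < +oo)%E.

(** [fine] sends an infinite value to 0, so [Int] represents the integral only on functions known to
    be in [L1]. *)
Definition Int f : R := fine (gint mu f).

Lemma gint_ge0E f : (forall x, 0 <= f x) ->
  gint mu f = \esum_(x in [set: V]) (f x * mu x)%:E.
Proof.
move=> f0; rewrite /gint [X in (_ - X)%E]esum1 ?sube0; last first.
  by move=> x _; rewrite /funrneg max_r ?oppr_le0// mul0r.
by apply: eq_esum => x _; rewrite /funrpos max_l.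
Qed.

Lemma gint_ge0 f : (forall x, 0 <= f x) -> (0 <= gint mu f)%E.
Proof.
by move=> f0; rewrite gint_ge0E//; apply: esum_ge0 => x _; rewrite lee_fin mulr_ge0.
Qed.

Lemma L1_le f g : (forall x, `|f x| <= g x) -> L1 g -> L1 f.
Proof.
move=> fg; apply: le_lt_trans; apply: le_esum => x _.
by rewrite lee_fin ler_wpM2r// (le_trans (fg x))// ler_norm.
Qed.

Lemma esum_norm_ge0 f : (0 <= \esum_(x in [set: V]) (`|f x| * mu x)%:E)%E.
Proof. by apply: esum_ge0 => x _; rewrite lee_fin mulr_ge0. Qed.

Lemma L1D f g : L1 f -> L1 g -> L1 (fun x => f x + g x).
Proof.
move=> lf lg; rewrite /L1.
apply: (@le_lt_trans _ _ (\esum_(x in [set: V])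
   ((`|f x| * mu x)%:E + (`|g x| * mu x)%:E))%E).
  by apply: le_esum => x _; rewrite -EFinD -mulrDl lee_fin ler_wpM2r// ler_normD.
rewrite esumD; first exact: lte_add_pinfty.
  by move=> x _; rewrite lee_fin mulr_ge0.
by move=> x _; rewrite lee_fin mulr_ge0.
Qed.

Lemma L1_bound f B : (forall x, 0 <= f x) ->
  (forall A, finite_set A -> \sum_(x \in A) (f x * mu x) <= B) ->
  (\esum_(x in [set: V]) (f x * mu x)%:E <= B%:E)%E.
Proof.
move=> f0 fB; apply: ge_ereal_sup => _ [A [finA _] <-].
by rewrite fsumEFin// lee_fin; exact: fB.
Qed.

Lemma L1_fsum f A : (forall x, 0 <= f x) -> finite_set A ->
  ((\sum_(x \in A) (f x * mu x))%:E <= \esum_(x in [set: V]) (f x * mu x)%:E)%E.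
Proof. by move=> f0 finA; apply: esum_ge; exists A; rewrite ?fsumEFin. Qed.

Lemma L1_fin f : L1 f -> (\esum_(x in [set: V]) (`|f x| * mu x)%:E) \is a fin_num.
Proof. by move=> lf; rewrite ge0_fin_numE// esum_norm_ge0. Qed.

Lemma ge0_L1 f : (forall x, 0 <= f x) -> (gint mu f < +oo)%E -> L1 f.
Proof.
move=> f0; rewrite gint_ge0E// /L1.
by under [X in _ -> (X < _)%E]eq_esum do rewrite ger0_norm//.
Qed.

Lemma L1Z c f : L1 f -> L1 (fun x => c * f x).
Proof.
move=> lf; rewrite /L1.
apply: (@le_lt_trans _ _ (`|c| * fine (\esum_(x in [set: V]) (`|f x| * mu x)%:E))%:E);
  last exact: ltry.
apply: ge_ereal_sup => _ [A [finA _] <-].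
rewrite fsumEFin// lee_fin.
under eq_fsbigr do rewrite normrM -mulrA.
rewrite -mulr_fsumr; apply: ler_wpM2l => //.
by rewrite -lee_fin fineK ?L1_fin//; exact: L1_fsum.
Qed.

Lemma L1N f : L1 f -> L1 (fun x => - f x).
Proof. by apply: le_lt_trans; apply: le_esum => x _; rewrite normrN. Qed.

Lemma L1B f g : L1 f -> L1 g -> L1 (fun x => f x - g x).
Proof. by move=> lf lg; apply: L1D => //; exact: L1N. Qed.

Lemma L1_ext f g : (forall x, f x = g x) -> L1 f -> L1 g.
Proof. by move=> fg; rewrite (_ : f = g)//; exact/funext. Qed.

Lemma L1_norm f : L1 f -> L1 (fun x => `|f x|).
Proof. by rewrite /L1; under [X in _ -> (X < _)%E]eq_esum do rewrite normr_id. Qed.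

Lemma L1_posneg_fin f : L1 f ->
  (\esum_(x in [set: V]) (f^\+ x * mu x)%:E)%E \is a fin_num /\
  (\esum_(x in [set: V]) (f^\- x * mu x)%:E)%E \is a fin_num.
Proof.
move=> lf; split; rewrite ge0_fin_numE.
- apply: le_lt_trans lf; apply: le_esum => x _; rewrite lee_fin ler_wpM2r//.
  by rewrite /funrpos ge_max normr_ge0 ler_norm.
- by apply: esum_ge0 => x _; rewrite lee_fin mulr_ge0// /funrpos le_max lexx orbT.
- apply: le_lt_trans lf; apply: le_esum => x _; rewrite lee_fin ler_wpM2r//.
  by rewrite /funrneg ge_max normr_ge0 -normrN ler_norm.
- by apply: esum_ge0 => x _; rewrite lee_fin mulr_ge0// /funrneg le_max lexx orbT.
Qed.

Lemma L1_posneg f :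
  (\esum_(x in [set: V]) (f^\+ x * mu x)%:E < +oo)%E ->
  (\esum_(x in [set: V]) (f^\- x * mu x)%:E < +oo)%E -> L1 f.
Proof.
move=> fp fn; have pn x : `|f x| = f^\+ x + f^\- x.
  by have /(congr1 (fun k => k x)) := funrposDneg f.
rewrite /L1.
under eq_esum do rewrite pn mulrDl EFinD.
rewrite esumD; first exact: lte_add_pinfty.
  by move=> x _; rewrite lee_fin mulr_ge0// funrpos_ge0.
by move=> x _; rewrite lee_fin mulr_ge0// funrneg_ge0.
Qed.

Lemma gint_fin f : L1 f -> gint mu f = (Int f)%:E.
Proof.
by move=> /L1_posneg_fin[fp fn]; rewrite /Int fineK// /gint fin_numB fp fn.
Qed.

Lemma IntD f g : L1 f -> L1 g -> Int (fun x => f x + g x) = Int f + Int g.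
Proof.
move=> lf lg; have lfg := L1D lf lg.
apply/EFin_inj; rewrite EFinD -!gint_fin// /gint.
have [fp fn] := L1_posneg_fin lf; have [gp gn] := L1_posneg_fin lg.
have [fgp fgn] := L1_posneg_fin lfg.
set h := fun x => _ in lfg fgp fgn *.
have pnE (k : V -> R) x : k x = k^\+ x - k^\- x.
  by have /(congr1 (fun k => k x)) := funrposBneg k.
(* With the negative parts moved across, the identity involves nonnegative sums only, which are
   additive; finiteness of all six sums then allows subtracting back in [R]. *)
have E : (\esum_(x in [set: V]) (h^\+ x * mu x)%:E +
          \esum_(x in [set: V]) (f^\- x * mu x)%:E +
          \esum_(x in [set: V]) (g^\- x * mu x)%:E =
          \esum_(x in [set: V]) (h^\- x * mu x)%:E +
          \esum_(x in [set: V]) (f^\+ x * mu x)%:E +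
          \esum_(x in [set: V]) (g^\+ x * mu x)%:E)%E.
  have pos0 k x : (0 <= (k^\+ x * mu x)%:E)%E.
    by rewrite lee_fin mulr_ge0// funrpos_ge0.
  have neg0 k x : (0 <= (k^\- x * mu x)%:E)%E.
    by rewrite lee_fin mulr_ge0// funrneg_ge0.
  do 4 (rewrite -esumD; [|by move=> x _; rewrite ?adde_ge0..]).
  apply: eq_esum => x _; rewrite -!EFinD -!mulrDl; congr (_ * _)%:E.
  have := pnE f x; have := pnE g x; have : f x + g x = h^\+ x - h^\- x by exact: (pnE h x).
  lra.
move: E.
rewrite -(fineK fp) -(fineK fn) -(fineK gp) -(fineK gn) -(fineK fgp) -(fineK fgn).
rewrite -!(EFinD, EFinN) => E; have {}E := EFin_inj E; congr EFin; lra.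
Qed.

Lemma Int_ge0 f : (forall x, 0 <= f x) -> 0 <= Int f.
Proof. by move=> f0; apply: fine_ge0; exact: gint_ge0. Qed.

Lemma eq_Int f g : (forall x, f x = g x) -> Int f = Int g.
Proof. by move=> fg; congr Int; exact/funext. Qed.

Lemma IntN f : L1 f -> Int (fun x => - f x) = - Int f.
Proof.
move=> lf; have := IntD lf (L1N lf).
rewrite (eq_Int (g := fun=> 0)) => [|x]; last by rewrite subrr.
rewrite {1}/Int gint_ge0E// esum1 => [/=|x _]; last by rewrite mul0r.
by move/esym/eqP; rewrite addr_eq0 => /eqP ->; rewrite opprK.
Qed.

Lemma IntB f g : L1 f -> L1 g -> Int (fun x => f x - g x) = Int f - Int g.
Proof. by move=> lf lg; rewrite IntD ?IntN//; exact: L1N. Qed.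

Lemma le_Int f g : L1 f -> L1 g -> (forall x, f x <= g x) -> Int f <= Int g.
Proof.
by move=> lf lg fg; rewrite -subr_ge0 -IntB//; apply: Int_ge0 => x; rewrite subr_ge0.
Qed.

Lemma ge0_IntE f : L1 f -> (forall x, 0 <= f x) ->
  (Int f)%:E = \esum_(x in [set: V]) (f x * mu x)%:E.
Proof. by move=> lf f0; rewrite -gint_fin// gint_ge0E. Qed.

Lemma fsum_le_Int f A : L1 f -> (forall x, 0 <= f x) -> finite_set A ->
  \sum_(x \in A) (f x * mu x) <= Int f.
Proof. by move=> lf f0 finA; rewrite -lee_fin ge0_IntE//; exact: L1_fsum. Qed.

Lemma point_le_Int f x : L1 f -> (forall x, 0 <= f x) -> f x * mu x <= Int f.
Proof.
by move=> lf f0; have := fsum_le_Int lf f0 (finite_set1 x); rewrite fsbig_set1.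
Qed.

(** A nonnegative sum is the supremum of its finite partial sums, so one bound on these yields
    summability and the estimate together. *)
Lemma Int_bound f B : (forall x, 0 <= f x) ->
  (forall A, finite_set A -> \sum_(x \in A) (f x * mu x) <= B) ->
  L1 f /\ Int f <= B.
Proof.
move=> f0 fB; have lB := L1_bound f0 fB.
have lf : L1 f by apply: ge0_L1 => //; rewrite gint_ge0E// (le_lt_trans lB)// ltry.
by split => //; rewrite -lee_fin ge0_IntE.
Qed.

(** For nonnegative data, partial sums give one inequality, and the same inequality with the inverse
    factor gives the other. Splitting [f] into its positive and negative parts, and then changing
    the sign of [c], covers the general case. *)
Lemma IntZ c f : L1 f -> Int (fun x => c * f x) = c * Int f.
Proof.
have ge0case k g : 0 <= k -> (forall x, 0 <= g x) -> L1 g ->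
    Int (fun x => k * g x) <= k * Int g.
  move=> k0 g0 lg; have kg0 x : 0 <= k * g x by rewrite mulr_ge0.
  apply: (Int_bound kg0 _).2 => A finA.
  under eq_fsbigr do rewrite -mulrA.
  by rewrite -mulr_fsumr ler_wpM2l//; exact: fsum_le_Int.
have ge0eq k g : 0 <= k -> (forall x, 0 <= g x) -> L1 g ->
    Int (fun x => k * g x) = k * Int g.
  move=> k0 g0 lg; move: (k0); rewrite le_eqVlt => /predU1P[<-|kgt0].
    rewrite mul0r (eq_Int (g := fun=> 0)) => [|x]; last by rewrite mul0r.
    by rewrite {1}/Int gint_ge0E// esum1 => [//|x _]; rewrite mul0r.
  apply/eqP; rewrite eq_le ge0case//= -ler_pdivlMl//.
  rewrite (eq_Int (f := g) (g := fun x => k^-1 * (k * g x))) => [|x].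
    by rewrite mulrC; apply: le_trans (ge0case _ _ _ _ _) _ => //;
      [rewrite invr_ge0|move=> x; rewrite mulr_ge0|exact: L1Z|rewrite mulrC].
  by rewrite mulrA mulVf ?mul1r// gt_eqF.
have signed k g : 0 <= k -> L1 g -> Int (fun x => k * g x) = k * Int g.
  move=> k0 lg.
  have lgp : L1 g^\+.
    apply: L1_le (L1_norm lg) => x; rewrite ger0_norm ?funrpos_ge0//.
    by rewrite /funrpos ge_max normr_ge0 ler_norm.
  have lgn : L1 g^\-.
    apply: L1_le (L1_norm lg) => x; rewrite ger0_norm ?funrneg_ge0//.
    by rewrite /funrneg ge_max normr_ge0 -normrN ler_norm.
  have gE x : g x = g^\+ x - g^\- x.
    by have /(congr1 (fun k => k x)) := funrposBneg g.
  have gp0 x : 0 <= g^\+ x := funrpos_ge0 g x.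
  have gn0 x : 0 <= g^\- x := funrneg_ge0 g x.
  rewrite (eq_Int gE) IntB// mulrBr -!ge0eq// -IntB; [|exact: L1Z..].
  by apply: eq_Int => x; rewrite {1}gE mulrBr.
move=> lf; have [c0|c0] := leP 0 c; first exact: signed.
rewrite (eq_Int (g := fun x => - (- c * f x))) => [|x]; last by rewrite mulNr opprK.
by rewrite IntN ?signed ?mulNr ?opprK ?oppr_ge0 ?ltW//; exact: L1Z.
Qed.

Lemma Int_cut f A : (forall x, 0 <= f x) -> finite_set A ->
  L1 (fun x => if x \in A then f x else 0) /\
  Int (fun x => if x \in A then f x else 0) = \sum_(x \in A) (f x * mu x).
Proof.
move=> f0 finA; set h := fun x => _.
have h0 x : 0 <= h x by rewrite /h; case: ifP.
have E : (\esum_(x in [set: V]) (h x * mu x)%:E = (\sum_(x \in A) (f x * mu x))%:E)%E.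
  rewrite -fsumEFin// -esum_fset//; last by move=> x _; rewrite lee_fin mulr_ge0.
  rewrite [RHS]esum_mkcond; apply: eq_esum => x _.
  by rewrite /h; case: ifP => //; rewrite mul0r.
have lh : L1 h by apply: ge0_L1; rewrite ?gint_ge0E// E ltry.
by split=> //; apply/EFin_inj; rewrite ge0_IntE.
Qed.

(** * Fatou's lemma and its reverse along a filter *)

Section Limits.
Context {T : Type} {F : set_system T} {FF : ProperFilter F}.

(** The measure is atomic: every finite partial sum passes to the limit along an arbitrary proper
    filter and stays below the limit of the bounds. This permits its use along an ultrafilter. *)
Lemma Fatou (f_ : T -> V -> R) f (beta_ : T -> R) (beta : R) :
  (forall i x, 0 <= f_ i x) -> (forall i, L1 (f_ i)) ->
  (forall x, f_ i x @[i --> F] --> f x) ->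
  (forall i, Int (f_ i) <= beta_ i) -> beta_ i @[i --> F] --> beta ->
  L1 f /\ Int f <= beta.
Proof.
move=> f0 lf cf fb cb; apply: Int_bound => [x|A finA].
  by apply: cvgr_to_ge (cf x) _; apply: nearW => i.
have cs : (\sum_(x \in A) (f_ i x * mu x)) @[i --> F] --> \sum_(x \in A) (f x * mu x).
  by apply: cvg_fsum => // x; apply: cvgMr_tmp; exact: cf.
rewrite -subr_ge0; apply: cvgr_to_ge (cvgB cb cs) _; apply: nearW => i.
by rewrite subr_ge0; apply: le_trans (fb i); exact: fsum_le_Int.
Qed.

(* Outside the finite set where [omega] is below [C / eps], the functions
   [eps * omega * g_ i - f_ i] are nonnegative, so Fatou's lemma applies to them. *)
Lemma reverse_Fatou (f_ g_ : T -> V -> R) f g (omega : V -> R)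
    (gamma_ : T -> R) (gamma B C : R) :
  (forall x, 0 <= omega x) -> (forall M, finite_set [set x | omega x <= M]) ->
  0 <= C -> (forall i x, 0 <= g_ i x) ->
  (forall i, L1 (fun x => omega x * g_ i x)) ->
  (forall i, Int (fun x => omega x * g_ i x) <= B) ->
  (forall i, L1 (f_ i)) -> (forall i x, f_ i x <= C * g_ i x) ->
  (forall x, f_ i x @[i --> F] --> f x) ->
  (forall x, g_ i x @[i --> F] --> g x) ->
  (forall i, gamma_ i <= Int (f_ i)) -> gamma_ i @[i --> F] --> gamma ->
  L1 f /\ gamma <= Int f.
Proof.
move=> om0 omfin C0 g0 lg gB lf fg cf cg cb cgam.
have g0' x : 0 <= g x by apply: cvgr_to_ge (cg x) _; apply: nearW => i.
have [lomg _] : L1 (fun x => omega x * g x) /\ Int (fun x => omega x * g x) <= B.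
  apply: (@Fatou (fun i x => omega x * g_ i x) _ (fun=> B)) => //.
  - by move=> i x; rewrite mulr_ge0.
  - by move=> x; apply: cvgMl_tmp; exact: cg.
  - exact: cvg_cst.
have key eps : 0 < eps -> L1 f /\ gamma - eps * B <= Int f.
  move=> eps0; pose S := [set x | omega x <= C / eps].
  have finS : finite_set S by exact: omfin.
  pose cut (k : V -> R) x := if x \in S then C * k x else 0.
  have cutP k : (forall x, 0 <= k x) -> L1 (cut k) /\
      Int (cut k) = \sum_(x \in S) (C * k x * mu x).
    by move=> k0; apply: Int_cut => // x; rewrite mulr_ge0.
  pose h k l x := eps * (omega x * k x) - l x + cut k x.
  have lh i : L1 (h (g_ i) (f_ i)).
    by apply: L1D; [apply: L1B => //; exact: L1Z|exact: (cutP _ _).1].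
  have [|||||lhl Ih] := @Fatou (fun i => h (g_ i) (f_ i)) (h g f)
    (fun i => eps * B - gamma_ i + \sum_(x \in S) (C * g_ i x * mu x))
    (eps * B - gamma + \sum_(x \in S) (C * g x * mu x)).
  - move=> i x; rewrite /h /cut; case: ifPn => [_|].
      by have := fg i x; have : 0 <= eps * (omega x * g_ i x);
        [rewrite !mulr_ge0// ltW|lra].
    move=> /negP; rewrite inE /S/= => /negP; rewrite -ltNge => Sx.
    rewrite addr0 subr_ge0 (le_trans (fg i x))// mulrA ler_wpM2r//.
    by rewrite mulrC -ler_pdivrMr// ltW.
  - by [].
  - move=> x; apply: cvgD.
      by apply: cvgB => //; apply: cvgMl_tmp; apply: cvgMl_tmp; exact: cg.
    by rewrite /cut; case: ifP => _; [apply: cvgMl_tmp; exact: cg|exact: cvg_cst].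
  - move=> i; rewrite IntD; [|apply: L1B => //; exact: L1Z|exact: (cutP _ _).1].
    rewrite IntB//; last exact: L1Z.
    rewrite IntZ// (cutP _ (g0 i)).2 lerD2r lerB// ler_wpM2l//.
    exact: ltW.
  - apply: cvgD; first by apply: cvgB => //; exact: cvg_cst.
    by apply: cvg_fsum => // x; apply: cvgMr_tmp; apply: cvgMl_tmp; exact: cg.
  have lomk := L1Z eps lomg.
  have [lcut Icut] := cutP _ g0'.
  (* Summability of [f] follows from that of the three terms, and in the estimate of its integral
     the finite sums over [S] cancel. *)
  have fE x : f x = eps * (omega x * g x) + cut g x - h g f x by rewrite /h; ring.
  have lfl : L1 f.
    by apply: (L1_ext (fun x => esym (fE x))); apply: L1B => //; exact: L1D.
  split => //; rewrite (eq_Int fE) IntB//; last exact: L1D.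
  rewrite IntD// Icut.
  have : 0 <= Int (fun x => eps * (omega x * g x)).
    by apply: Int_ge0 => x; rewrite !mulr_ge0// ltW.
  by lra.
have [lfl _] := key 1 ltr01; split => //.
apply/ler_addgt0Pl => e e0.
have B0 : 0 <= B.
  have [i _] := filter_ex (filterT : F setT).
  by apply: le_trans (gB i); apply: Int_ge0 => x; rewrite mulr_ge0.
(* The [+ 1] keeps the denominator positive when [B = 0]. *)
have [|_] := key (e / (B + 1)); first by rewrite divr_gt0// ltr_wpDl.
have : e / (B + 1) * B <= e.
  by rewrite mulrAC ler_pdivrMr ?ltr_wpDl// ler_pM2l// lerDl.
by lra.
Qed.

End Limits.
End WeightedSums.

Arguments eq_Int [R V mu f g] _.

(** * Powers and logarithms *)

Section RealPowers.
Variable R : realType.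
Implicit Types (x y q : R).

(** Away from 0 the power is differentiable; at 0 the radius [e ^ (1 / q)] works directly. *)
Lemma continuous_norm_powR q : 0 < q -> continuous (fun x : R => `|x| `^ q).
Proof.
move=> q0 x; have [->|x0] := eqVneq x 0.
  suff: (fun y : R => `|y| `^ q) @ (0 : R) --> (0 : R).
    by rewrite /continuous_at normr0 powR0 ?gt_eqF.
  apply/cvgrPdist_lt => e e0.
  have d0 : 0 < e `^ q^-1 by exact: powR_gt0.
  have eE : (e `^ q^-1) `^ q = e by rewrite -powRrM mulVf ?gt_eqF// powRr1// ltW.
  apply: filterS (@nbhs0_lt _ R _ d0) => y yd.
  rewrite sub0r normrN ger0_norm ?powR_ge0// -[ltRHS]eE.
  by apply: gt0_ltr_powR; rewrite ?nnegrE ?powR_ge0.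
have n0 : 0 < `|x| by rewrite normr_gt0.
apply: (@continuous_comp _ _ _ (fun y : R => `|y|) (fun y => y `^ q)).
  exact: norm_continuous.
apply: differentiable_continuous; apply/derivable1_diffP.
by apply: derivable_powR; rewrite in_itv/= n0.
Qed.

(** The inequality [ln s < s] at [s = 1 / |x|] bounds [- |x| ln |x|] by 1. This gives continuity of
    [x ^+ 2 * ln (x ^+ 2)] at 0. *)
Lemma norm_sqr_ln_le x : `|x| <= 1 -> `|x ^+ 2 * ln (x ^+ 2)| <= 2 * `|x|.
Proof.
have [->|x0] := eqVneq x 0; first by rewrite expr0n/= mul0r normr0 mulr0.
move=> x1; have n0 : 0 < `|x| by rewrite normr_gt0.
rewrite -[x ^+ 2]real_normK ?num_real// lnXn// normrM.
rewrite (ger0_norm (exprn_ge0 2 (normr_ge0 x))) normrMn (ler0_norm (ln_le0 x1)).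
have i0 : 0 < `|x|^-1 by rewrite invr_gt0.
have := ltW (ln_sublinear i0).
rewrite lnV ?posrE// => /(ler_wpM2l (ltW n0)); rewrite divff ?gt_eqF// => H.
have : `|x| * (`|x| * - ln `|x|) <= `|x| * 1 by rewrite ler_wpM2l// ltW.
by rewrite expr2 mulr2n; lra.
Qed.

Lemma continuous_sqr_ln : continuous (fun x : R => x ^+ 2 * ln (x ^+ 2)).
Proof.
move=> x; have [->|x0] := eqVneq x 0.
  suff: (fun y : R => y ^+ 2 * ln (y ^+ 2)) @ (0 : R) --> (0 : R).
    by rewrite /continuous_at [X in _ --> X -> _](_ : _ = 0 ^+ 2 * ln (0 ^+ 2)) ?expr0n ?mul0r.
  apply/cvgrPdist_lt => e e0.
  have e20 : 0 < Num.min 1 (e / 2) by rewrite lt_min ltr01 divr_gt0.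
  apply: filterS (@nbhs0_lt _ R _ e20) => y; rewrite lt_min => /andP[/ltW y1 ye].
  by rewrite sub0r normrN (le_lt_trans (norm_sqr_ln_le y1))// -ltr_pdivlMl// mulrC.
have cs : {for x, continuous (fun y : R => y ^+ 2)} by exact: exprn_continuous.
apply: cvgM => //.
apply: (@continuous_comp _ _ _ (fun y : R => y ^+ 2) (@ln R)) => //.
by apply: continuous_ln; rewrite exprn_even_gt0.
Qed.

Lemma powRB2 x q : 0 <= x -> 2 < q -> x `^ (q - 2) * x ^+ 2 = x `^ q.
Proof.
move=> x0 q2; rewrite -powR_mulrn// -powRD ?subrK//.
by rewrite gt_eqF//; lra.
Qed.

Lemma young_powR x y q : 2 < q ->
  `|x| `^ (q - 2) * y ^+ 2 <= `|x| `^ q + `|y| `^ q.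
Proof.
move=> q2; rewrite -[y ^+ 2]real_normK ?num_real//.
have q0 : 0 <= q - 2 by lra.
have [yx|/ltW xy] := leP `|y| `|x|.
  rewrite ler_wpDr ?powR_ge0// -(@powRB2 `|x| q)//.
  by rewrite ler_wpM2l ?powR_ge0// lerXn2r ?nnegrE.
rewrite ler_wpDl ?powR_ge0// -(@powRB2 `|y| q)//.
by rewrite ler_wpM2r ?exprn_ge0// ge0_ler_powR// nnegrE.
Qed.

(** The fractions [x / (x + y)] and [y / (x + y)] lie in the unit interval, where a power with
    exponent at least 1 does not increase them, and they add up to 1. *)
Lemma powR_superadditive x y q : 0 <= x -> 0 <= y -> 1 <= q ->
  x `^ q + y `^ q <= (x + y) `^ q.
Proof.
move=> x0 y0 q1; have [xy0|xy0] := eqVneq (x + y) 0.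
  have [-> ->] : x = 0 /\ y = 0 by split; lra.
  by rewrite addr0 powR0 ?addr0// gt_eqF//; lra.
have s0 : 0 < x + y by rewrite lt0r xy0 addr_ge0.
have le_frac z : 0 <= z -> z <= x + y -> z `^ q <= (x + y) `^ q * (z / (x + y)).
  move=> z0 zs; have [->|zn0] := eqVneq z 0.
    by rewrite powR0 ?mul0r ?mulr0// gt_eqF//; lra.
  have zp : 0 < z by rewrite lt0r zn0.
  have {1}-> : z = (x + y) * (z / (x + y)) by rewrite mulrCA divff ?mulr1.
  rewrite powRM ?divr_ge0 ?(ltW s0)// ler_wpM2l ?powR_ge0// ge1r_powR//.
  by rewrite divr_gt0//= ler_pdivrMr// mul1r.
apply: (le_trans (lerD (le_frac x x0 _) (le_frac y y0 _))); rewrite ?lerDl ?lerDr//.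
by rewrite -mulrDr -mulrDl divff// mulr1.
Qed.

Lemma powR_half_sum x y q : 0 <= x -> 0 <= y -> 1 <= q ->
  ((x + y) / 2) `^ q <= (x `^ q + y `^ q) / 2.
Proof.
move=> x0 y0 q1.
have h01 : 0 <= (2^-1 : R) <= 1 by apply/andP; split; lra.
have := @convex_powR R q q1 (Itv01 (andP h01).1 (andP h01).2) x y.
rewrite !inE/= !in_itv/= !andbT => /(_ x0 y0).
have -> : (x + y) / 2 = 2^-1 * x + (1 - 2^-1) * y by field.
have -> : (x `^ q + y `^ q) / 2 = 2^-1 * x `^ q + (1 - 2^-1) * y `^ q by field.
exact.
Qed.

(* The scalar form of Clarkson's inequality; [A], [B], [X], [Y] are to be the
   squared norms of [(u + v) / 2], [(u - v) / 2], [u] and [v]. *)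
Lemma clarkson_powR (A B X Y q : R) : 0 <= A -> 0 <= B -> 0 <= X -> 0 <= Y ->
  1 <= q -> A + B = (X + Y) / 2 ->
  A `^ q + B `^ q <= (X `^ q + Y `^ q) / 2.
Proof.
move=> A0 B0 X0 Y0 q1 AB.
by rewrite (le_trans (powR_superadditive _ _ _))// AB powR_half_sum.
Qed.

Lemma norm_powR_sqr x q : `|x| `^ q = (x ^+ 2) `^ (q / 2).
Proof.
rewrite -[x ^+ 2]real_normK ?num_real// -powR_mulrn// -powRrM.
by congr (_ `^ _); field.
Qed.

Lemma sqrt_powR x q : 0 <= x -> Num.sqrt x `^ q = x `^ (q / 2).
Proof. by move=> x0; rewrite -powR12_sqrt// -powRrM; congr (_ `^ _); field. Qed.

End RealPowers.

(** * The space [W1p] *)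

(* The integrands are locked because failing unifications of two integrals would
   otherwise unfold them down to the operations of [R]. *)
HB.lock Definition densW (R : realType) (V : choiceType) (e : rel V) (mu : V -> R)
    (p : R) (u : V -> R) (x : V) : R :=
  gradn e mu u x `^ p + `|u x| `^ p.

Section Sobolev.
Variables (R : realType) (V : choiceType) (e : rel V) (mu : V -> R) (p : R).
Hypothesis e_sym : symmetric e.
Hypothesis e_lf : locally_finite e.
Hypothesis mu_gt0 : forall x, 0 < mu x.
Hypothesis p_gt2 : 2 < p.
Implicit Types (u v phi : V -> R).

Let mu_ge0 x : 0 <= mu x. Proof. exact: ltW. Qed.
Local Hint Extern 0 (is_true (0 <= mu _)) => exact: mu_ge0 : core.
Let p_gt0 : 0 < p. Proof. by move: p_gt2; lra. Qed.
Local Hint Extern 0 (is_true (0 < p)) => exact: p_gt0 : core.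
Local Notation L1 := (L1 mu).
Local Notation Int := (Int mu).
Local Notation densW := (densW e mu p).

Lemma densWE u x : densW u x = gradn e mu u x `^ p + `|u x| `^ p.
Proof. by rewrite unlock. Qed.

Lemma Gamma_ge0 u x : 0 <= Gamma e mu u u x.
Proof.
rewrite /Gamma mulr_ge0 ?invr_ge0 ?mulr_ge0//.
by apply: fsumr_ge0 => y _; rewrite -expr2 sqr_ge0.
Qed.

Lemma GammaZ t u v x :
  Gamma e mu (fun y => t * u y) (fun y => t * v y) x = t ^+ 2 * Gamma e mu u v x.
Proof.
rewrite /Gamma mulrCA; congr (_ * _); rewrite mulr_fsumr.
by apply: eq_fsbigr => y _; ring.
Qed.

Lemma Gamma_parallelogram u v x :
  Gamma e mu (fun y => (u y + v y) / 2) (fun y => (u y + v y) / 2) x +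
  Gamma e mu (fun y => (u y - v y) / 2) (fun y => (u y - v y) / 2) x =
  (Gamma e mu u u x + Gamma e mu v v x) / 2.
Proof.
rewrite /Gamma -!mulrDr -!fsbig_split/=; [|exact: e_lf..].
rewrite -mulrA mulr_fsuml; congr (_ * _).
by apply: eq_fsbigr => y _; field.
Qed.

Lemma gradn_powRE u x : gradn e mu u x `^ p = Gamma e mu u u x `^ (p / 2).
Proof. by rewrite /gradn sqrt_powR// Gamma_ge0. Qed.

Lemma densW_ge0 u x : 0 <= densW u x.
Proof. by rewrite densWE addr_ge0 ?powR_ge0. Qed.

Lemma gradn_powRB2 u x :
  gradn e mu u x `^ (p - 2) * Gamma e mu u u x = gradn e mu u x `^ p.
Proof.
rewrite -[X in _ * X]sqr_sqrtr ?Gamma_ge0// -/(gradn e mu u x).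
by rewrite powRB2// sqrtr_ge0.
Qed.

Lemma gradnZ t u x : gradn e mu (fun y => t * u y) x `^ p =
  `|t| `^ p * gradn e mu u x `^ p.
Proof.
by rewrite !gradn_powRE GammaZ powRM ?Gamma_ge0 ?sqr_ge0// norm_powR_sqr.
Qed.

Lemma densWZ t u x : densW (fun y => t * u y) x = `|t| `^ p * densW u x.
Proof. by rewrite !densWE gradnZ normrM powRM// -mulrDr. Qed.

(** Both [Gamma] and the square of the value obey the parallelogram law, so the scalar inequality
    applies to each with exponent [p / 2 >= 1]. *)
Lemma densW_clarkson u v x :
  densW (fun y => (u y + v y) / 2) x + densW (fun y => (u y - v y) / 2) x <=
  (densW u x + densW v x) / 2.
Proof.
have p1 : 1 <= p / 2 by move: p_gt2; lra.
rewrite !densWE !gradn_powRE !norm_powR_sqr.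
have H1 := clarkson_powR (Gamma_ge0 _ x) (Gamma_ge0 _ x) (Gamma_ge0 u x)
  (Gamma_ge0 v x) p1 (Gamma_parallelogram u v x).
have H2 := @clarkson_powR R (((u x + v x) / 2) ^+ 2) (((u x - v x) / 2) ^+ 2)
  (u x ^+ 2) (v x ^+ 2) _ (sqr_ge0 _) (sqr_ge0 _) (sqr_ge0 _) (sqr_ge0 _) p1.
have {}H2 := H2 ltac:(field).
by lra.
Qed.

Section Convergence.
Context {T : Type} {F : set_system T} {FF : Filter F}.

Lemma cvg_Gamma (u_ v_ : T -> V -> R) u v x :
  (forall y, u_ i y @[i --> F] --> u y) -> (forall y, v_ i y @[i --> F] --> v y) ->
  Gamma e mu (u_ i) (v_ i) x @[i --> F] --> Gamma e mu u v x.
Proof.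
move=> cu cv; apply: cvgMl_tmp; apply: cvg_fsum; first exact: e_lf.
by move=> y; apply: cvgM; apply: cvgB.
Qed.

Lemma cvg_norm_powR (u_ : T -> R) (u q : R) : 0 < q ->
  u_ i @[i --> F] --> u -> `|u_ i| `^ q @[i --> F] --> `|u| `^ q.
Proof. by move=> q0; exact: (continuous_cvg _ (@continuous_norm_powR R q q0 u)). Qed.

Lemma cvg_gradn_powR (u_ : T -> V -> R) u x :
  (forall y, u_ i y @[i --> F] --> u y) ->
  gradn e mu (u_ i) x `^ p @[i --> F] --> gradn e mu u x `^ p.
Proof.
move=> cu; rewrite gradn_powRE; under eq_fun do rewrite gradn_powRE.
rewrite -[X in X `^ _]ger0_norm ?Gamma_ge0//.
under eq_fun do rewrite -[X in X `^ _]ger0_norm ?Gamma_ge0//.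
by apply: cvg_norm_powR; [rewrite divr_gt0|exact: cvg_Gamma].
Qed.

Lemma cvg_densW (u_ : T -> V -> R) u x :
  (forall y, u_ i y @[i --> F] --> u y) ->
  densW (u_ i) x @[i --> F] --> densW u x.
Proof.
move=> cu; rewrite densWE; under eq_fun do rewrite densWE.
apply: cvgD; first exact: cvg_gradn_powR.
exact: cvg_norm_powR.
Qed.

End Convergence.

(** * Approximation by finitely supported functions *)

Lemma normWE u : normW e mu p u = (gint mu (densW u) `^ p^-1)%E.
Proof. by rewrite /normW; congr (gint _ _ `^ _)%E; apply/funext => x; rewrite densWE. Qed.

Lemma L1_finite_support f : finite_set [set x | f x != 0] -> L1 f.
Proof.
move=> finf; have [lf _] := Int_cut mu_ge0 (fun x => normr_ge0 (f x)) finf.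
apply: (L1_le mu_ge0) lf => x; case: ifPn => //.
by move=> /negP; rewrite inE/= => /negP; rewrite negbK => /eqP ->; rewrite normr0.
Qed.

(** The gradient can be nonzero only on the support and at its neighbours; by symmetry and local
    finiteness of the edges these form a finite set. *)
Lemma L1_densW_Cc phi : Cc phi -> L1 (densW phi).
Proof.
move=> cphi; apply: L1_finite_support.
pose S := [set x | phi x != 0].
apply: (@sub_finite_set _ _ (S `|` \bigcup_(y in S) [set x | e y x])).
  move=> x /=; apply: contraNP => nx.
  have phi0 y : ~ S y -> phi y = 0 by move=> /negP; rewrite negbK => /eqP.
  have px : phi x = 0 by apply: phi0 => Sx; apply: nx; left.
  have G0 : Gamma e mu phi phi x = 0.
    rewrite /Gamma fsbig1 ?mulr0// => y /= exy.
    rewrite px phi0 ?subrr ?mulr0// => Sy; apply: nx; right.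
    by exists y => //=; rewrite e_sym.
  have p20 : p / 2 != 0 by rewrite gt_eqF// divr_gt0.
  have p0 : p != 0 by rewrite gt_eqF.
  by rewrite densWE gradn_powRE G0 px normr0 !powR0// addr0.
rewrite finite_setU; split => //.
by apply: bigcup_finite => // y _; exact: e_lf.
Qed.

Lemma normW_lt u eps : 0 < eps ->
  (normW e mu p u < eps%:E)%E <-> L1 (densW u) /\ Int (densW u) < eps `^ p.
Proof.
move=> eps0; have g0 := gint_ge0 mu_ge0 (densW_ge0 u).
rewrite normWE.
split=> [H|[lu iu]].
  have lu : L1 (densW u).
    apply: ge0_L1; first exact: densW_ge0.
    by apply: (@lty_poweRy _ _ p^-1); rewrite ?invr_eq0 ?gt_eqF// (lt_trans H)// ltry.
  split=> //; move: H; rewrite gint_fin// poweR_EFin lte_fin => H.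
  have -> : Int (densW u) = (Int (densW u) `^ p^-1) `^ p.
    by rewrite -powRrM mulVf ?gt_eqF// powRr1// Int_ge0//; exact: densW_ge0.
  by apply: gt0_ltr_powR; rewrite ?nnegrE ?powR_ge0// ltW.
rewrite gint_fin// poweR_EFin lte_fin.
have -> : eps = (eps `^ p) `^ p^-1 by rewrite -powRrM mulfV ?gt_eqF// powRr1// ltW.
apply: gt0_ltr_powR; rewrite ?nnegrE ?invr_gt0 ?powR_ge0//.
by apply: Int_ge0 => //; exact: densW_ge0.
Qed.

(** Here [delta] plays the role of [eps ^ p], so that later estimates deal with integrals and never
    with their roots. *)
Lemma W1pP u : W1p e mu p u <->
  forall delta, 0 < delta -> exists2 phi, Cc phi &
    L1 (densW (fun x => u x - phi x)) /\ Int (densW (fun x => u x - phi x)) < delta.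
Proof.
split=> H d d0.
  have [phi cphi /normW_lt] := H _ (powR_gt0 p^-1 d0).
  rewrite -powRrM mulVf ?gt_eqF// powRr1 ?ltW// => /(_ (powR_gt0 _ d0)) Hp.
  by exists phi.
have [phi cphi Hp] := H _ (powR_gt0 p d0).
by exists phi => //; apply/normW_lt.
Qed.

(** Drop the half-difference from Clarkson's inequality and rescale the midpoint by 2. This
    quasi-triangle inequality serves in place of Minkowski's. *)
Lemma L1_densW_add u v : L1 (densW u) -> L1 (densW v) ->
  L1 (densW (fun x => u x + v x)) /\
  Int (densW (fun x => u x + v x)) <= 2 `^ p * (Int (densW u) + Int (densW v)) / 2.
Proof.
move=> lu lv; pose g x := 2 `^ p / 2 * (densW u x + densW v x).
have lg : L1 g by apply: (L1Z mu_ge0); exact: (L1D mu_ge0).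
have le x : densW (fun x => u x + v x) x <= g x.
  have := densW_clarkson u v x; have := densW_ge0 (fun y => (u y - v y) / 2) x.
  have -> : (fun x => u x + v x) = (fun x => 2 * ((u x + v x) / 2)).
    by apply/funext => y; field.
  rewrite densWZ ger0_norm// => H1 H2.
  rewrite /g -mulrA ler_wpM2l ?powR_ge0// mulrC; lra.
have l : L1 (densW (fun x => u x + v x)).
  by apply: (L1_le mu_ge0) lg => x; rewrite ger0_norm ?densW_ge0.
split=> //; apply: le_trans (le_Int mu_ge0 l lg le) _.
rewrite /g IntZ//; last exact: (L1D mu_ge0).
by rewrite IntD// mulrAC.
Qed.

Lemma W1p_L1 u : W1p e mu p u -> L1 (densW u).
Proof.
move=> /W1pP/(_ 1 ltr01)[phi cphi [l _]].
have -> : u = (fun x => (u x - phi x) + phi x) by apply/funext => x; rewrite subrK.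
by apply: (L1_densW_add l (L1_densW_Cc cphi)).1.
Qed.

Lemma W1pZ t u : W1p e mu p u -> W1p e mu p (fun x => t * u x).
Proof.
move=> /W1pP wu; apply/W1pP => d d0.
have tp : 0 < `|t| `^ p + 1 by rewrite ltr_wpDl// powR_ge0.
have [phi cphi [l il]] := wu _ (divr_gt0 d0 tp).
exists (fun x => t * phi x).
  by apply: sub_finite_set cphi => x /=; rewrite mulf_eq0 negb_or => /andP[].
have E x : `|t| `^ p * densW (fun x => u x - phi x) x =
    densW (fun x => t * u x - t * phi x) x.
  by rewrite -densWZ; congr (densW _ x); apply/funext => y; rewrite mulrBr.
split; first exact: L1_ext E (L1Z mu_ge0 _ l).
rewrite -(eq_Int E) IntZ//.
move: il; rewrite ltr_pdivlMr// => /(le_lt_trans _); apply.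
rewrite mulrC ler_wpM2l ?lerDl//; apply: Int_ge0 => // x; exact: densW_ge0.
Qed.

Lemma Cc_W1p phi : Cc phi -> W1p e mu p phi.
Proof.
move=> cphi; apply/W1pP => d d0; exists phi => //.
have E x : densW (fun x => phi x - phi x) x = 0.
  rewrite (_ : (fun x => _) = (fun x => 0 * phi x)).
    by rewrite densWZ normr0 powR0 ?mul0r// gt_eqF.
  by apply/funext => y; rewrite subrr mul0r.
have l0 : L1 (densW (fun x => phi x - phi x)).
  apply: L1_finite_support; rewrite (_ : [set x | _] = set0)//.
  by apply/seteqP; split => // x /=; rewrite E eqxx.
split=> //; rewrite (eq_Int E).
rewrite (eq_Int (g := fun x => 0 * densW (fun x => phi x - phi x) x)).
  by rewrite IntZ// mul0r.
by move=> x; rewrite mul0r.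
Qed.

Lemma Cc_comb (h : R -> R -> R) phi psi : h 0 0 = 0 ->
  Cc phi -> Cc psi -> Cc (fun x => h (phi x) (psi x)).
Proof.
move=> h0 cphi cpsi.
apply: (@sub_finite_set _ _ ([set x | phi x != 0] `|` [set x | psi x != 0])).
  move=> x /=; apply: contraPP => /not_orP[/negP + /negP].
  by rewrite !negbK => /eqP -> /eqP ->; rewrite h0 eqxx.
by rewrite finite_setU.
Qed.

(* [m n] is the least energy of a test function that is close to [u] on [D n].
   Since midpoints of such functions are of the same kind, Clarkson's inequality
   makes almost minimizers a Cauchy sequence, and they converge to [u] pointwise. *)
Lemma W1p_bounded_limit u B (D : nat -> set V) :
  {homo D : n k / (n <= k)%N >-> n `<=` k} -> (forall x, exists n, D n x) ->
  (forall n, exists phi, [/\ Cc phi,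
     forall x, D n x -> `|phi x - u x| <= n.+1%:R^-1 & Int (densW phi) <= B]) ->
  W1p e mu p u.
Proof.
move=> Dmono Dcov approx.
pose C n := [set phi | Cc phi /\ forall x, D n x -> `|phi x - u x| <= n.+1%:R^-1].
pose E n := [set Int (densW phi) | phi in C n].
pose m n := inf (E n).
have E_lb n : lbound (E n) 0.
  by move=> _ [phi _ <-]; apply: Int_ge0 => // x; exact: densW_ge0.
have E_ne n : E n !=set0.
  by have [phi [? ? _]] := approx n; exists (Int (densW phi)); exists phi.
have m_le n phi : C n phi -> m n <= Int (densW phi).
  by move=> Cphi; apply: ge_inf; [exists 0|exists phi].
have mB n : m n <= B.
  by have [phi [? ? iB]] := approx n; apply: le_trans iB; exact: m_le.
have Cmono n k phi : (n <= k)%N -> C k phi -> C n phi.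
  move=> nk [cphi Hphi]; split=> // x Dx.
  by rewrite (le_trans (Hphi _ (Dmono _ _ nk _ Dx)))// lef_pV2 ?posrE// ler_nat.
have m_mono : nondecreasing_seq m.
  move=> n k nk; apply: lb_le_inf => // _ [phi Cphi <-].
  exact/m_le/(Cmono _ _ _ nk).
have cm : m @ \oo --> sup (range m).
  by apply: nondecreasing_cvgn => //; exists B => _ [n _ <-].
have m_sup n : m n <= sup (range m).
  by apply: ub_le_sup; [exists B => _ [k _ <-]|exists n].
have /choice[phi phiP] n : exists phi, C n phi /\ Int (densW phi) <= m n + n.+1%:R^-1.
  have [||_ [phi Cphi <-] /ltW iphi] := @inf_adherent _ (E n) n.+1%:R^-1.
  - by rewrite invr_gt0.
  - by split=> //; exists 0.
  - by exists phi.
have phi_u x : phi k x @[k --> \oo] --> u x.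
  have [n Dn] := Dcov x; apply/cvgrPdistC_le => eps eps0; near=> k.
  have nk : (n <= k)%N by near: k; exact: nbhs_infty_ge.
  have [[_ Hphi] _] := phiP k.
  rewrite (le_trans (Hphi _ (Dmono _ _ nk _ Dn)))//.
  by apply: ltW; near: k; exact: (cvgr_lt (0 : R) (@cvg_harmonic R) _ eps0).
have Cc_diff n k : Cc (fun x => (phi n x - phi k x) / 2).
  apply: (Cc_comb (h := fun s t => (s - t) / 2)); first by rewrite subrr mul0r.
    exact: (phiP n).1.1.
  exact: (phiP k).1.1.
(* Both energies are at most [sup (range m) + 1 / (n + 1)], while the midpoint belongs to [C n] and
   so has energy at least [m n]; Clarkson's inequality leaves the difference for the
   half-difference. *)
have cauchy n k : (n <= k)%N ->
    Int (densW (fun x => (phi n x - phi k x) / 2)) <=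
    sup (range m) - m n + n.+1%:R^-1.
  move=> nk; have [Cn In] := phiP n; have [Ck Ik] := phiP k.
  have Ckn := Cmono _ _ _ nk Ck.
  have Cmid : C n (fun x => (phi n x + phi k x) / 2).
    split.
      apply: (Cc_comb (h := fun s t => (s + t) / 2)); first by rewrite addr0 mul0r.
        exact: Cn.1.
      exact: Ckn.1.
    move=> x Dx; have := Cn.2 x Dx; have := Ckn.2 x Dx.
    rewrite !ler_norml; set c := _%:R^-1 => /andP[H1 H2] /andP[H3 H4].
    by apply/andP; split; lra.
  have lmid := L1_densW_Cc Cmid.1.
  have ln := L1_densW_Cc Cn.1; have lk := L1_densW_Cc Ck.1.
  have lnk : L1 (fun x => 2^-1 * (densW (phi n) x + densW (phi k) x)).
    by apply: L1Z => //; exact: L1D.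
  have ldiff := L1_densW_Cc (Cc_diff n k).
  have : Int (densW (fun x => (phi n x + phi k x) / 2)) +
      Int (densW (fun x => (phi n x - phi k x) / 2)) <=
      2^-1 * (Int (densW (phi n)) + Int (densW (phi k))).
    rewrite -(IntD mu_ge0 lmid ldiff) -(IntD mu_ge0 ln lk) -(IntZ mu_ge0); last exact: L1D.
    apply: (le_Int mu_ge0 _ lnk) => [|x]; first exact: L1D.
    by rewrite [leRHS]mulrC; exact: densW_clarkson.
  have := m_le _ _ Cmid; have := m_sup k.
  have : k.+1%:R^-1 <= n.+1%:R^-1 :> R by rewrite lef_pV2 ?posrE// ler_nat.
  move: In Ik (m_sup n); move: (n.+1%:R^-1) (k.+1%:R^-1) (sup _) (m n) (m k).
  move: (Int _) (Int _) (Int _) (Int _) => *; lra.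
apply/W1pP => d d0.
have c0 : sup (range m) - m n + n.+1%:R^-1 @[n --> \oo] --> (0 : R).
  rewrite -[X in _ --> X](addr0 (0 : R)) -{1}(subrr (sup (range m))).
  by apply: cvgD; [apply: cvgB => //; exact: cvg_cst|exact: cvg_harmonic].
(* The factor [2 ^ p] pays for the halving of the difference in [cauchy]. *)
have d'0 : 0 < d / 2 `^ p by rewrite divr_gt0// powR_gt0.
have /cvgrPdistC_lt/(_ _ d'0)[n _ /(_ n (leqnn n))] := c0.
rewrite /= subr0 => /(le_lt_trans (ler_norm _)) Hn.
exists (phi n); first exact: (phiP n).1.1.
(* With [n] fixed, Fatou's lemma in [k] carries the Cauchy estimate over to [u]. The shift by [n]
   makes that estimate available for every [k]. *)
pose w k x := (phi n x - phi (k + n)%N x) / 2.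
have [|||||l il] := @Fatou R V mu mu_ge0 _ \oo _ (fun k => densW (w k))
  (densW (fun x => (phi n x - u x) / 2))
  (fun=> sup (range m) - m n + n.+1%:R^-1) (sup (range m) - m n + n.+1%:R^-1).
- by move=> k x; exact: densW_ge0.
- by move=> k; exact/L1_densW_Cc/Cc_diff.
- move=> x; apply: cvg_densW => y; apply: cvgMr_tmp; apply: cvgB; first exact: cvg_cst.
  by rewrite (cvg_shiftn n (fun k => phi k y)).
- by move=> k; apply: cauchy; rewrite leq_addl.
- exact: cvg_cst.
have DE x : 2 `^ p * densW (fun x => (phi n x - u x) / 2) x =
    densW (fun x => u x - phi n x) x.
  have -> : 2 `^ p = `|- 2 : R| `^ p by rewrite normrN ger0_norm.
  by rewrite -densWZ; congr (densW _ x); apply/funext => y; field.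
split; first exact: L1_ext DE (L1Z mu_ge0 _ l).
rewrite -(eq_Int DE) IntZ// -ltr_pdivlMl ?powR_gt0//.
by rewrite (le_lt_trans il)// mulrC.
Unshelve. all: by end_near. Qed.

(** On the finite set [D n] some [u_ i] is uniformly close to [u]. A test function close to that
    [u_ i] in energy is close to it at every vertex, because [mu] is bounded below, and the
    quasi-triangle inequality bounds its energy independently of [n]. *)
Lemma W1p_limit (mu_min : R) (T : Type) (F : set_system T)
    (FF : ProperFilter F) (u_ : T -> V -> R) u B (D : nat -> set V) :
  0 < mu_min -> (forall x, mu_min <= mu x) ->
  (forall n, finite_set (D n)) ->
  {homo D : n k / (n <= k)%N >-> n `<=` k} -> (forall x, exists n, D n x) ->
  (forall i, W1p e mu p (u_ i)) -> (forall i, Int (densW (u_ i)) <= B) ->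
  (forall x, u_ i x @[i --> F] --> u x) -> W1p e mu p u.
Proof.
move=> mm0 mumin finD Dmono Dcov wu uB cu.
apply: (@W1p_bounded_limit u (2 `^ p * (B + mu_min) / 2) D) => // n.
(* Half of the tolerance is for [u_ i] against [u], half for the test function against [u_ i]. *)
pose c : R := n.+1%:R^-1 / 2.
have c0 : 0 < c by rewrite divr_gt0// invr_gt0.
have c1 : c <= 1.
  rewrite ler_pdivrMr// mul1r (@le_trans _ _ 1) ?ler1n//.
  by rewrite invf_le1// ler1n.
have : F (\bigcap_(x in D n) [set i | `|u_ i x - u x| <= c]).
  have /finite_fsetP[X ->] := finD n; apply: filter_bigI => x _.
  by have /cvgrPdistC_le/(_ _ c0) := cu x.
move=> /filter_ex[i Hi].
(* A deviation larger than [c] at a single vertex would already contribute this much energy. *)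
have [|phi cphi [l il]] := (W1pP (u_ i)).1 (wu i) (mu_min * c `^ p).
  by rewrite mulr_gt0// powR_gt0.
exists phi; split=> //.
  move=> x Dx; have ux := Hi x Dx; rewrite /= in ux.
  have ud : `|phi x - u_ i x| <= c.
    rewrite distrC leNgt; apply/negP => cl.
    have := point_le_Int mu_ge0 x l (densW_ge0 _).
    rewrite leNgt => /negP; apply; rewrite (lt_le_trans il)// mulrC.
    apply: ler_pM; rewrite ?powR_ge0 ?(ltW mm0)//.
    rewrite (@le_trans _ _ (`|u_ i x - phi x| `^ p))//.
      by rewrite ge0_ler_powR ?nnegrE// ltW.
    by rewrite densWE lerDr powR_ge0.
  have -> : phi x - u x = (phi x - u_ i x) + (u_ i x - u x) by ring.
  rewrite (le_trans (ler_normD _ _))//.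
  have -> : n.+1%:R^-1 = c + c :> R by rewrite /c; field.
  exact: lerD.
have lu : L1 (densW (u_ i)) by exact: W1p_L1.
have E x : `|-1| `^ p * densW (fun x => u_ i x - phi x) x =
    densW (fun x => phi x - u_ i x) x.
  by rewrite -densWZ; congr (densW _ x); apply/funext => y; ring.
have Im : Int (densW (fun x => phi x - u_ i x)) =
    Int (densW (fun x => u_ i x - phi x)).
  by rewrite -(eq_Int E) IntZ// normrN normr1 powR1 mul1r.
have lm : L1 (densW (fun x => phi x - u_ i x)).
  exact: L1_ext E (L1Z mu_ge0 _ l).
have := (L1_densW_add lu lm).2; rewrite Im.
rewrite (_ : (fun x => _) = phi); last by apply/funext => x; ring.
have ilm : Int (densW (fun x => u_ i x - phi x)) <= mu_min.
  apply: ltW (lt_le_trans il _); rewrite ger_pMr//.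
  rewrite [leRHS](_ : 1 = 1 `^ p); last by rewrite powR1.
  by apply: ge0_ler_powR; rewrite ?nnegrE ?ler01 ?(ltW p_gt0) ?(ltW c0).
move=> H; apply: le_trans H _; rewrite ler_pM2r ?invr_gt0 ?ltr0n//.
by apply: (ler_wpM2l (powR_ge0 2 p)); exact: lerD (uB i) ilm.
Qed.

End Sobolev.

(** * The energy and the Nehari manifold *)

HB.lock Definition coupl (R : realType) (V : choiceType) (p : R) (u v : V -> R) (x : V) : R :=
  `|u x| `^ (p - 2) * v x ^+ 2.

HB.lock Definition lcoupl (R : realType) (V : choiceType) (p : R) (u v : V -> R) (x : V) : R :=
  `|u x| `^ (p - 2) * (v x ^+ 2 * ln (v x ^+ 2)).

HB.lock Definition densH (R : realType) (V : choiceType) (e : rel V) (mu : V -> R)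
    (p : R) (c u : V -> R) (x : V) : R :=
  gradn e mu u x `^ p + c x * `|u x| `^ p.

(** * Pointwise estimates and scaling of the coupling densities *)

Section Coupling.
Variables (R : realType) (V : choiceType) (p : R).
Hypothesis p_gt4 : 4 < p.
Implicit Types (u v : V -> R).

Let p_gt2 : 2 < p. Proof. by move: p_gt4; lra. Qed.
Let p_gt0 : 0 < p. Proof. by move: p_gt4; lra. Qed.
Local Hint Extern 0 (is_true (2 < p)) => exact: p_gt2 : core.
Local Hint Extern 0 (is_true (0 < p)) => exact: p_gt0 : core.

Local Notation coupl := (coupl p).
Local Notation lcoupl := (lcoupl p).

Lemma couplE u v x : coupl u v x = `|u x| `^ (p - 2) * v x ^+ 2.
Proof. by rewrite unlock. Qed.

Lemma lcouplE u v x : lcoupl u v x = `|u x| `^ (p - 2) * (v x ^+ 2 * ln (v x ^+ 2)).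
Proof. by rewrite unlock. Qed.

Lemma coupl_ge0 u v x : 0 <= coupl u v x.
Proof. by rewrite couplE mulr_ge0 ?powR_ge0 ?sqr_ge0. Qed.

Lemma coupl_le u v x : coupl u v x <= `|u x| `^ p + `|v x| `^ p.
Proof. by rewrite couplE; exact: young_powR. Qed.

Lemma ln_sqr x : x != 0 -> ln (x ^+ 2) = 2 / p * ln (`|x| `^ p).
Proof.
move=> x0; rewrite -[x ^+ 2]real_normK ?num_real// lnXn ?normr_gt0//.
by rewrite ln_powR mulr2n; field; rewrite gt_eqF.
Qed.

(** Monotonicity of [ln] applied to [ln (v ^ 2) = (2 / p) ln (|v| ^ p)]; where [v] vanishes, so do
    both sides. *)
Lemma lcoupl_le u v s x : `|v x| `^ p <= s ->
  lcoupl u v x <= 2 / p * ln s * coupl u v x.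
Proof.
move=> vs; rewrite lcouplE couplE.
have [->|v0] := eqVneq (v x) 0; first by rewrite expr0n/= mul0r !mulr0.
have vp : 0 < `|v x| `^ p by rewrite powR_gt0// normr_gt0.
rewrite [leRHS]mulrCA ler_wpM2l ?powR_ge0// [leRHS]mulrC ler_wpM2l ?sqr_ge0//.
rewrite ln_sqr// ler_wpM2l ?divr_ge0 ?(ltW p_gt0)//.
by rewrite ler_ln ?posrE// (lt_le_trans vp).
Qed.

Lemma powR2_scale t : 0 < t -> t `^ (p - 2) * t ^+ 2 = t `^ p.
Proof. by move=> t0; rewrite powRB2// ltW. Qed.

Lemma couplZ t u v x : 0 < t ->
  coupl (fun y => t * u y) (fun y => t * v y) x = t `^ p * coupl u v x.
Proof.
move=> t0; rewrite !couplE normrM powRM// (gtr0_norm t0) -(powR2_scale t0).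
by rewrite exprMn; ring.
Qed.

(** The additional term with [ln (t ^+ 2)] is what allows [nehari_ray] to solve for [t]
    explicitly. *)
Lemma lcouplZ t u v x : 0 < t ->
  lcoupl (fun y => t * u y) (fun y => t * v y) x =
  t `^ p * (lcoupl u v x + ln (t ^+ 2) * coupl u v x).
Proof.
move=> t0; rewrite !lcouplE couplE normrM powRM// (gtr0_norm t0) -(powR2_scale t0).
have [->|v0] := eqVneq (v x) 0; first by rewrite mulr0 expr0n/=; ring.
have v20 : 0 < v x ^+ 2 by rewrite exprn_even_gt0.
have t20 : 0 < t ^+ 2 by rewrite exprn_gt0.
by rewrite exprMn lnM ?posrE//; ring.
Qed.

Section Convergence.
Context {T : Type} {F : set_system T} {FF : Filter F}.
Variables (u_ v_ : T -> V -> R) (u v : V -> R).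
Hypothesis cu : forall x, u_ i x @[i --> F] --> u x.
Hypothesis cv : forall x, v_ i x @[i --> F] --> v x.

Lemma cvg_coupl x : coupl (u_ i) (v_ i) x @[i --> F] --> coupl u v x.
Proof.
rewrite couplE; under eq_fun do rewrite couplE.
apply: cvgM; first by apply: cvg_norm_powR => //; move: p_gt4; lra.
exact: (continuous_cvg _ (@exprn_continuous R 2 (v x))).
Qed.

Lemma cvg_lcoupl x : lcoupl (u_ i) (v_ i) x @[i --> F] --> lcoupl u v x.
Proof.
rewrite lcouplE; under eq_fun do rewrite lcouplE.
apply: cvgM; first by apply: cvg_norm_powR => //; move: p_gt4; lra.
exact: (continuous_cvg _ (@continuous_sqr_ln R (v x))).
Qed.

End Convergence.
End Coupling.

(** An infinite set contains more than [v / mu_min] points, whose total mass exceeds the volume [v].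
    This turns (A2) into finiteness of the sublevel sets of the potentials. *)
Lemma finite_volume_finite {R : realType} {V : choiceType} (mu : V -> R)
    (mu_min : R) (D : set V) :
  0 < mu_min -> (forall x, mu_min <= mu x) -> (volume mu D < +oo)%E ->
  finite_set D.
Proof.
move=> mm0 mumin volD; apply: contrapT => infD.
have mu0 x : 0 <= mu x by rewrite (le_trans (ltW mm0)).
pose v := fine (volume mu D).
have vE : volume mu D = v%:E.
  by rewrite fineK// ge0_fin_numE//; apply: esum_ge0 => x _; rewrite lee_fin.
have [B BD cB] := infinite_set_fset (Num.truncn (v / mu_min)).+1 infD.
suff : v < v by rewrite ltxx.
have : \sum_(x \in [set` B]) mu x <= v.
  by rewrite -lee_fin -vE -fsumEFin//; apply: esum_ge; exists [set` B].
apply: lt_le_trans.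
rewrite fsbig_finite//= set_fsetK.
apply: (@lt_le_trans _ _ (\sum_(x <- finmap.enum_fset B) mu_min)); last first.
  by apply: ler_sum => x _.
rewrite big_const_seq count_predT iter_addr_0 -mulr_natr mulrC -ltr_pdivrMr//.
apply: lt_le_trans (truncnS_gt _) _.
by rewrite ler_nat.
Qed.

(** By compactness of a segment the image of [U] has a cluster point, and an ultrafilter converges
    to its cluster points. One ultrafilter thus gives limits at all vertices at once, without a
    diagonal argument. *)
Lemma ultra_bounded_cvg {R : realType} {T : Type} {U : set_system T}
    {UU : UltraFilter U} (f : T -> R) (M : R) :
  (forall i, `|f i| <= M) -> exists l : R, f i @[i --> U] --> l.
Proof.
move=> fM; have fU : U (f @^-1` `[- M, M]%classic).
  by apply: filterE => i; rewrite /= in_itv/= -ler_norml.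
have [l [_ lU]] := @segment_compact R (- M) M (f @ U) _ fU.
exists l => A lA; have [//|UnA] := in_ultra_setVsetC (f @^-1` A) UU.
by have [y []] := lU (~` A) A UnA lA.
Qed.

(** * Admissible pairs, and the energy and its derivative as real integrals *)

Section Energy.
Variables (R : realType) (V : choiceType) (e : rel V) (mu : V -> R) (p : R).
Variables (mu_min V0 : R) (a b : V -> R).
Hypothesis e_sym : symmetric e.
Hypothesis e_lf : locally_finite e.
Hypothesis mu_min_gt0 : 0 < mu_min.
Hypothesis mu_ge : forall x, mu_min <= mu x.
Hypothesis V0_gt0 : 0 < V0.
Hypothesis a_ge : forall x, V0 <= a x.
Hypothesis b_ge : forall x, V0 <= b x.
Hypothesis p_gt4 : 4 < p.
Implicit Types (u v c : V -> R).

Let mu_gt0 x : 0 < mu x. Proof. exact: lt_le_trans (mu_ge x). Qed.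
Let mu_ge0 x : 0 <= mu x. Proof. exact: ltW (mu_gt0 x). Qed.
Local Hint Extern 0 (is_true (0 < mu _)) => exact: mu_gt0 : core.
Local Hint Extern 0 (is_true (0 <= mu _)) => exact: mu_ge0 : core.
Let p_gt2 : 2 < p. Proof. by move: p_gt4; lra. Qed.
Let p_gt0 : 0 < p. Proof. by move: p_gt4; lra. Qed.
Local Hint Extern 0 (is_true (2 < p)) => exact: p_gt2 : core.
Local Hint Extern 0 (is_true (0 < p)) => exact: p_gt0 : core.
Local Notation L1 := (L1 mu).
Local Notation Int := (Int mu).
Local Notation coupl := (coupl p).
Local Notation lcoupl := (lcoupl p).
Local Notation densH := (densH e mu p).

Lemma densHE c u x : densH c u x = gradn e mu u x `^ p + c x * `|u x| `^ p.
Proof. by rewrite unlock. Qed.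

Lemma densH_ge0 c u x : 0 <= c x -> 0 <= densH c u x.
Proof. by move=> c0; rewrite densHE addr_ge0 ?mulr_ge0 ?powR_ge0. Qed.

Lemma densHZ c t u x : densH c (fun y => t * u y) x = `|t| `^ p * densH c u x.
Proof. by rewrite !densHE gradnZ// normrM powRM// mulrCA -mulrDr. Qed.

Lemma normH_powR c u : (forall x, 0 <= c x) ->
  (normH e mu p c u `^ p = gint mu (densH c u))%E.
Proof.
move=> c0; have -> : normH e mu p c u = (gint mu (densH c u) `^ p^-1)%E.
  by rewrite /normH; congr (gint _ _ `^ _)%E; apply/funext => x; rewrite densHE.
rewrite -poweRrM mulVf ?gt_eqF// poweRe1//.
by apply: gint_ge0 => // x; exact: densH_ge0.
Qed.

Lemma Hspace_L1 c u : (forall x, 0 <= c x) ->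
  Hspace e mu p c u <-> W1p e mu p u /\ L1 (fun x => c x * `|u x| `^ p).
Proof.
move=> c0; have cu0 x : 0 <= c x * `|u x| `^ p by rewrite mulr_ge0 ?powR_ge0.
split=> -[wu H]; split => //; first exact: ge0_L1.
by rewrite gint_fin// ltry.
Qed.

Lemma W1p_L1_norm u : W1p e mu p u -> L1 (fun x => `|u x| `^ p).
Proof.
move=> /(W1p_L1 e_sym e_lf mu_gt0 p_gt2); apply: L1_le => // x.
by rewrite ger0_norm ?powR_ge0// densWE lerDr powR_ge0.
Qed.

Lemma L1_densH c u : W1p e mu p u -> L1 (fun x => c x * `|u x| `^ p) ->
  L1 (densH c u).
Proof.
move=> /(W1p_L1 e_sym e_lf mu_gt0 p_gt2) lu lc.
apply: (L1_ext (fun x => esym (densHE c u x))); apply: L1D => //.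
by apply: L1_le lu => // x; rewrite ger0_norm ?powR_ge0// densWE lerDl powR_ge0.
Qed.

Lemma L1_between f g h : L1 f -> L1 h -> (forall x, f x <= g x <= h x) -> L1 g.
Proof.
move=> lf lh fgh; apply: (L1_le mu_ge0 (g := fun x => `|f x| + `|h x|)).
  move=> x; have /andP[fg gh] := fgh x; rewrite ler_norml.
  have := ler_norm (h x); have := ler_norm (- f x); rewrite normrN.
  by have := normr_ge0 (h x); have := normr_ge0 (f x); lra.
by apply: L1D => //; exact: L1_norm.
Qed.

Lemma L1_coupl u v : W1p e mu p u -> W1p e mu p v -> L1 (coupl u v).
Proof.
move=> /W1p_L1_norm lu /W1p_L1_norm lv; apply: L1_le (L1D _ lu lv) => // x.
by rewrite ger0_norm ?coupl_ge0//; exact: coupl_le.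
Qed.

(* The bound comes from [v] being bounded. *)
Lemma lcoupl_L1_above u v : W1p e mu p u -> W1p e mu p v ->
  exists2 g, L1 g & (forall x, 0 <= g x) /\ forall x, lcoupl u v x <= g x.
Proof.
move=> wu wv; have lv := W1p_L1_norm wv.
pose s := Int (fun x => `|v x| `^ p) / mu_min.
have vs x : `|v x| `^ p <= s.
  rewrite ler_pdivlMr//; apply: le_trans (point_le_Int mu_ge0 x lv _).
    by rewrite ler_wpM2l ?powR_ge0.
  by move=> y; exact: powR_ge0.
exists (fun x => `|2 / p * ln s| * coupl u v x).
  by apply: L1Z => //; exact: L1_coupl.
split=> x; first by rewrite mulr_ge0 ?coupl_ge0.
rewrite (le_trans (lcoupl_le p_gt4 u (vs x)))// ler_wpM2r ?coupl_ge0//.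
exact: ler_norm.
Qed.

(** This is the finite domain of [J] in terms of absolute summability, so that every integral
    involved is a real number; see [domJ_adm]. *)
Definition adm (w : (V -> R) * (V -> R)) : Prop :=
  [/\ W1p e mu p w.1, W1p e mu p w.2,
      L1 (fun x => a x * `|w.1 x| `^ p) & L1 (fun x => b x * `|w.2 x| `^ p)] /\
  (L1 (lcoupl w.1 w.2) /\ L1 (lcoupl w.2 w.1)).

Definition EN w : R := Int (densH a w.1) + Int (densH b w.2).
Definition EK w : R := Int (coupl w.1 w.2) + Int (coupl w.2 w.1).
Definition EL w : R := Int (lcoupl w.1 w.2) + Int (lcoupl w.2 w.1).

Let a0 x : 0 <= a x. Proof. by rewrite (le_trans _ (a_ge x))// ltW. Qed.
Let b0 x : 0 <= b x. Proof. by rewrite (le_trans _ (b_ge x))// ltW. Qed.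
Local Hint Extern 0 (is_true (0 <= a _)) => exact: a0 : core.
Local Hint Extern 0 (is_true (0 <= b _)) => exact: b0 : core.

Lemma J_gintE u v : J e mu p a b (u, v) =
  ((p^-1)%:E * (normH e mu p a u `^ p + normH e mu p b v `^ p)
   - (p^-1)%:E * gint mu (lcoupl u v) - (p^-1)%:E * gint mu (lcoupl v u))%E.
Proof.
by rewrite /J; congr (_ - _ * gint mu _ - _ * gint mu _)%E; apply/funext => x;
  rewrite lcouplE.
Qed.

Lemma cvg_densH (T : Type) (F : set_system T) (FF : Filter F) c
    (u_ : T -> V -> R) u x :
  (forall y, u_ i y @[i --> F] --> u y) ->
  densH c (u_ i) x @[i --> F] --> densH c u x.
Proof.
move=> cu; rewrite densHE; under eq_fun do rewrite densHE.
apply: cvgD; first exact: cvg_gradn_powR.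
by apply: cvgMl_tmp; exact: cvg_norm_powR.
Qed.

Lemma J_E w : adm w -> J e mu p a b w = ((EN w - EL w) / p)%:E.
Proof.
case: w => u v A; rewrite J_gintE; case: A => -[/= wu wv lu lv] [luv lvu].
rewrite (normH_powR u a0) (normH_powR v b0) (gint_fin mu_ge0 (L1_densH wu lu)).
rewrite (gint_fin mu_ge0 (L1_densH wv lv)) (gint_fin mu_ge0 luv) (gint_fin mu_ge0 lvu).
rewrite -!(EFinD, EFinM, EFinN) /EN /EL; congr EFin.
move: (Int (densH _ _)) (Int (densH _ _)) (Int (lcoupl _ _)) (Int (lcoupl _ _)).
by move=> *; field; rewrite gt_eqF.
Qed.

(** The positive parts of both logarithmic integrals are always finite. A divergent negative part
    would make [J] equal to [+oo]: the two integrals enter with the same sign and cannot cancel. *)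
Lemma domJ_adm w : domJ e mu p a b w <-> adm w.
Proof.
case: w => u v; split; last first.
  move=> A; have [[/= wu wv lu lv] _] := A.
  have JE := J_E A; split; [|split].
  - exact/(Hspace_L1 u a0).
  - exact/(Hspace_L1 v b0).
  - by rewrite JE ltry.
move=> -[/Hspace_L1-/(_ a0)[wu lu] [/Hspace_L1-/(_ b0)[wv lv] Jfin]].
have posfin u' v' : W1p e mu p u' -> W1p e mu p v' ->
    (\esum_(x in [set: V]) ((lcoupl u' v')^\+ x * mu x)%:E)%E \is a fin_num.
  move=> wu' wv'; have [g lg [g0 gle]] := lcoupl_L1_above wu' wv'.
  rewrite ge0_fin_numE; last first.
    by apply: esum_ge0 => x _; rewrite lee_fin mulr_ge0// funrpos_ge0.
  move: lg; apply: le_lt_trans; apply: le_esum => x _.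
  rewrite lee_fin ler_wpM2r// ger0_norm//.
  by rewrite /funrpos ge_max gle g0.
have neg0 u' v' : (0 <= \esum_(x in [set: V]) ((lcoupl u' v')^\- x * mu x)%:E)%E.
  by apply: esum_ge0 => x _; rewrite lee_fin mulr_ge0// funrneg_ge0.
suff [n1 n2] : (\esum_(x in [set: V]) ((lcoupl u v)^\- x * mu x)%:E < +oo)%E /\
    (\esum_(x in [set: V]) ((lcoupl v u)^\- x * mu x)%:E < +oo)%E.
  split; first by split.
  by split; apply: L1_posneg => //; rewrite ltey_eq posfin.
move: Jfin; rewrite J_gintE (normH_powR u a0) (normH_powR v b0).
rewrite (gint_fin mu_ge0 (L1_densH wu lu)) (gint_fin mu_ge0 (L1_densH wv lv)) /gint.
have := neg0 u v; have := neg0 v u; have := posfin u v wu wv; have := posfin v u wv wu.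
case: (esum _ (fun x => ((lcoupl u v)^\+ x * mu x)%:E)) => // p1.
case: (esum _ (fun x => ((lcoupl v u)^\+ x * mu x)%:E)) => // p2.
have pinv : 0 < p^-1 by rewrite invr_gt0.
case: (esum _ (fun x => ((lcoupl u v)^\- x * mu x)%:E)) => [n1| |] //;
case: (esum _ (fun x => ((lcoupl v u)^\- x * mu x)%:E)) => [n2| |] //= _ _ _ _;
  rewrite ?ltry// ?addeNy ?gt0_muleNy ?lte_fin//=.
Qed.

(** In the direction [w] itself [|u| ^ (p - 4) * u * u] becomes [|u| ^ (p - 2)], and the weights
    [(p - 2) / p] and [2 / p] of each logarithmic integral add up to 1; the non-logarithmic
    remainder is [2 / p * EK w]. *)
Lemma J'_E w : adm w -> J' e mu p a b w w = (EN w - EL w - 2 / p * EK w)%:E.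
Proof.
case: w => u v [[/= wu wv lu lv] [luv lvu]].
have cuv := L1_coupl wu wv; have cvu := L1_coupl wv wu.
have Hu := L1_densH wu lu; have Hv := L1_densH wv lv.
have sqrE q (t : R) : 2 < q -> `|t| `^ (q - 2) * t * t = `|t| `^ q.
  by move=> q2; rewrite -mulrA -expr2 -[t ^+ 2]real_normK ?num_real// powRB2.
have p42 (f g : V -> R) x : `|f x| `^ (p - 4) * f x * f x * (g x ^+ 2 * ln (g x ^+ 2)) =
    lcoupl f g x.
  rewrite lcouplE -(sqrE (p - 2)); last by move: p_gt4; lra.
  by congr (_ `^ _ * _ * _ * _); ring.
have p22 (f g : V -> R) x : `|f x| `^ (p - 2) * g x * (g x * ln (g x ^+ 2) + g x) =
    lcoupl f g x + coupl f g x.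
  by rewrite lcouplE couplE; ring.
rewrite /J' (_ : (fun x => _ + _ + _ + _) = fun x => densH a u x + densH b v x); last first.
  apply/funext => x; rewrite !gradn_powRB2// !densHE -(sqrE p (u x))// -(sqrE p (v x))//.
  by move: (powR _ _) (powR _ _) (powR _ _) (powR _ _) => *; ring.
rewrite (_ : (fun x => `|u x| `^ (p - 4) * _ * _ * _) = lcoupl u v);
  last exact/funext/p42.
rewrite (_ : (fun x => `|u x| `^ (p - 2) * v x * _) =
  fun x => lcoupl u v x + coupl u v x); last exact/funext/p22.
rewrite (_ : (fun x => `|v x| `^ (p - 4) * _ * _ * _) = lcoupl v u);
  last exact/funext/p42.
rewrite (_ : (fun x => `|v x| `^ (p - 2) * u x * _) =
  fun x => lcoupl v u x + coupl v u x); last exact/funext/p22.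
rewrite !gint_fin//; [|exact: L1D..].
rewrite -!(EFinD, EFinM, EFinN); congr EFin.
rewrite (IntD mu_ge0 Hu Hv) (IntD mu_ge0 luv cuv) (IntD mu_ge0 lvu cvu) /EN /EL /EK.
move: (Int (densH _ _)) (Int (densH _ _)) (Int (lcoupl _ _)) (Int (lcoupl _ _)).
move: (Int (coupl _ _)) (Int (coupl _ _)) => *; by field; rewrite gt_eqF.
Qed.

(** * Rays and a priori bounds on the Nehari manifold *)

Definition scale (t : R) (w : (V -> R) * (V -> R)) : (V -> R) * (V -> R) :=
  (fun x => t * w.1 x, fun x => t * w.2 x).

Lemma adm_scale t w : 0 < t -> adm w -> [/\ adm (scale t w),
  EN (scale t w) = t `^ p * EN w, EK (scale t w) = t `^ p * EK w &
  EL (scale t w) = t `^ p * (EL w + ln (t ^+ 2) * EK w)].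
Proof.
move=> t0; case: w => u v [[/= wu wv lu lv] [luv lvu]].
have cuv := L1_coupl wu wv; have cvu := L1_coupl wv wu.
have Hu := L1_densH wu lu; have Hv := L1_densH wv lv.
have lce f g : L1 (lcoupl f g) -> L1 (coupl f g) ->
    L1 (fun x => lcoupl f g x + ln (t ^+ 2) * coupl f g x).
  by move=> ? ?; apply: L1D => //; exact: L1Z.
have scaleE c f x : t `^ p * (c x * `|f x| `^ p) = c x * `|t * f x| `^ p.
  by rewrite normrM powRM// (gtr0_norm t0); ring.
have HE c f : Int (densH c (fun x => t * f x)) = Int (fun x => t `^ p * densH c f x).
  by apply: eq_Int => x; rewrite densHZ gtr0_norm.
have KE f g : Int (coupl (fun x => t * f x) (fun x => t * g x)) =
    Int (fun x => t `^ p * coupl f g x).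
  by apply: eq_Int => x; exact: couplZ.
have LE (f g : V -> R) x : t `^ p * (lcoupl f g x + ln (t ^+ 2) * coupl f g x) =
    lcoupl (fun x => t * f x) (fun x => t * g x) x.
  by rewrite lcouplZ.
split.
- split; split => /=.
  + exact: W1pZ.
  + exact: W1pZ.
  + exact: L1_ext (scaleE a u) (L1Z mu_ge0 _ lu).
  + exact: L1_ext (scaleE b v) (L1Z mu_ge0 _ lv).
  + by apply: (L1_ext (LE u v)); apply: L1Z => //; exact: lce.
  + by apply: (L1_ext (LE v u)); apply: L1Z => //; exact: lce.
- by rewrite /EN /= (HE a u) (HE b v) (IntZ mu_ge0 _ Hu) (IntZ mu_ge0 _ Hv) mulrDr.
- by rewrite /EK /= (KE u v) (KE v u) (IntZ mu_ge0 _ cuv) (IntZ mu_ge0 _ cvu) mulrDr.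
- have IE f g : L1 (lcoupl f g) -> L1 (coupl f g) ->
      Int (lcoupl (fun x => t * f x) (fun x => t * g x)) =
      t `^ p * (Int (lcoupl f g) + ln (t ^+ 2) * Int (coupl f g)).
    move=> l c; rewrite -(eq_Int (LE f g)) (IntZ mu_ge0 _ (lce _ _ l c)).
    by rewrite (IntD mu_ge0 l (L1Z mu_ge0 _ c)) (IntZ mu_ge0 _ c).
  rewrite /EL /EK /= (IE u v)// (IE v u)//.
  by move: (Int _) (Int _) (Int _) (Int _) => *; ring.
Qed.

Lemma EK_ge0 w : 0 <= EK w.
Proof. by rewrite addr_ge0//; apply: Int_ge0 => // x; exact: coupl_ge0. Qed.

Lemma nehariP w : nehari e mu p a b w <->
  [/\ adm w, w <> (cst 0, cst 0) & EN w - EL w - 2 / p * EK w = 0].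
Proof.
rewrite /nehari/= domJ_adm; split=> [[A [w0 H]]|[A w0 H]].
  by split=> //; move: H; rewrite J'_E// => -[].
by split=> //; split=> //; rewrite J'_E// H.
Qed.

Lemma J_nehari w : nehari e mu p a b w -> J e mu p a b w = (2 / p ^+ 2 * EK w)%:E.
Proof.
move=> /nehariP[A _ H]; rewrite J_E//; congr EFin.
have -> : EN w - EL w = 2 / p * EK w by apply/eqP; rewrite -subr_eq0 H.
by field; rewrite gt_eqF.
Qed.

Lemma EK_zero : EK (cst 0, cst 0) = 0.
Proof.
have l0 : Int (coupl (cst 0) (cst 0)) = 0.
  rewrite (eq_Int (g := fun x => 0 * 0 : R)) => [|x].
    rewrite IntZ ?mul0r//; apply: L1_finite_support => //.
    by rewrite (_ : [set x | _] = set0)//; apply/seteqP; split => // x /=; rewrite eqxx.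
  by rewrite couplE expr0n/= !mulr0.
by rewrite /EK/= l0 addr0.
Qed.

(* Along the ray [scale t w] the Nehari functional is
   [t `^ p * (EN w - EL w - 2 / p * EK w - ln (t ^+ 2) * EK w)]. *)
Lemma nehari_ray w : adm w -> 0 < EK w -> exists2 t, 0 < t &
  nehari e mu p a b (scale t w) /\ (EN w - EL w - 2 / p * EK w <= 0 -> t <= 1).
Proof.
move=> A K0; set r := EN w - EL w - 2 / p * EK w.
(* This [t] solves [ln (t ^+ 2) = r / EK w], and it is at most 1 when [r <= 0]. *)
exists (expR (r / EK w / 2)); first exact: expR_gt0.
set t := expR _; have t0 : 0 < t by exact: expR_gt0.
have lnt : ln (t ^+ 2) = r / EK w by rewrite lnXn// expRK; field; rewrite gt_eqF.
have [At EtN EtK EtL] := adm_scale t0 A.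
split.
  apply/nehariP; split=> //.
    move=> w0; have := EK_zero; rewrite -w0 EtK => /eqP.
    by rewrite mulf_eq0 !gt_eqF ?powR_gt0.
  rewrite EtN EtK EtL lnt divfK ?gt_eqF//.
  by rewrite /r; ring.
move=> r0; rewrite /t -expR0 ler_expR.
by rewrite mulr_le0_ge0// mulr_le0_ge0// invr_ge0 ltW.
Qed.

(** The single vertex [x] contributes at least [V0 * mu_min] times the [p]-th power of the entry to
    the integral. *)
Lemma norm_powR_le_EN w x : adm w ->
  `|w.1 x| `^ p <= EN w / (V0 * mu_min) /\ `|w.2 x| `^ p <= EN w / (V0 * mu_min).
Proof.
case: w => u v [[/= wu wv lu lv] _].
have Hu := L1_densH wu lu; have Hv := L1_densH wv lv.
have c0 : 0 < V0 * mu_min by exact: mulr_gt0.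
have le c f : (forall x, V0 <= c x) -> L1 (densH c f) ->
    `|f x| `^ p * (V0 * mu_min) <= Int (densH c f).
  move=> cge lf; have c_ge0 y : 0 <= c y by rewrite (le_trans _ (cge y))// ltW.
  have d0 y : 0 <= densH c f y by exact: densH_ge0.
  apply: le_trans (point_le_Int mu_ge0 x lf d0).
  rewrite mulrA; apply: ler_pM; rewrite ?mulr_ge0 ?powR_ge0 ?(ltW V0_gt0) ?(ltW mu_min_gt0)//.
  rewrite mulrC (@le_trans _ _ (c x * `|f x| `^ p))//.
    by rewrite ler_wpM2r ?powR_ge0.
  by rewrite !densHE lerDr powR_ge0.
have nu := le _ _ a_ge Hu; have nv := le _ _ b_ge Hv.
have i1 : 0 <= Int (densH a u) by apply: Int_ge0 => // y; exact: densH_ge0.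
have i2 : 0 <= Int (densH b v) by apply: Int_ge0 => // y; exact: densH_ge0.
rewrite !(ler_pdivlMr _ _ c0) /EN/=.
by move: nu nv i1 i2; move: (Int _) (Int _) (powR _ _) (powR _ _) => *; split; lra.
Qed.

Lemma EL_le w s : adm w -> (forall x, `|w.1 x| `^ p <= s /\ `|w.2 x| `^ p <= s) ->
  EL w <= 2 / p * ln s * EK w.
Proof.
case: w => u v [[/= wu wv lu lv] [luv lvu]] ws.
have cuv := L1_coupl wu wv; have cvu := L1_coupl wv wu.
rewrite /EL /EK/= mulrDr -!IntZ//; apply: lerD; apply: le_Int => //; try exact: L1Z.
  by move=> x; apply: lcoupl_le => //; exact: (ws x).2.
by move=> x; apply: lcoupl_le => //; exact: (ws x).1.
Qed.

(** With [EN w = c * s], every entry has [p]-th power at most [s], so [EL_le] and the Nehari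
    equation give [c * s <= 2 / p * EK w * (ln s + 1)]. Then [ln s + 1 <= s] yields the lower bound
    on [EK w], and [ln s + 1 <= 2 * sqrt s] the upper bound on [s]. *)
Lemma nehari_bounds w : nehari e mu p a b w ->
  V0 * mu_min * p / 2 <= EK w /\
  EN w <= V0 * mu_min * (4 * EK w / (p * (V0 * mu_min))) ^+ 2.
Proof.
move=> /nehariP[A w0 H]; set c := V0 * mu_min; have c0 : 0 < c by exact: mulr_gt0.
have p0 : 0 < p by [].
pose s := EN w / c; have ws x := norm_powR_le_EN x A; rewrite -/c -/s in ws.
have NE : EN w = c * s by rewrite /s mulrC divfK// gt_eqF.
have s0 : 0 < s.
  have s_ge0 : 0 <= s.
    have [x _] : exists x : V, True.
      apply: contrapT => nV; apply: w0; rewrite [w]surjective_pairing.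
      by congr (_, _); apply/funext => x; exfalso; apply: nV; exists x.
    by apply: le_trans (ws x).1; exact: powR_ge0.
  rewrite lt0r s_ge0 andbT; apply/eqP => s0; apply: w0.
  have z (t : R) : `|t| `^ p <= s -> t = 0.
    rewrite s0 => H0; apply/normr0_eq0; apply: (@powR_eq0_eq0 _ _ p).
    by apply/eqP; rewrite eq_le H0 powR_ge0.
  rewrite [w]surjective_pairing; congr (_, _); apply/funext => x; apply: z.
    exact: (ws x).1.
  exact: (ws x).2.
have K0 := EK_ge0 w.
have := EL_le A ws; have -> : EL w = c * s - 2 / p * EK w by rewrite -NE; lra.
rewrite lerBlDr => main0.
have main : c * s <= 2 / p * EK w * (ln s + 1) by apply: le_trans main0 _; lra.
have p20 : 0 <= 2 / p * EK w by rewrite mulr_ge0// divr_ge0// ltW.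
have ln1 (y : R) : 0 < y -> ln y + 1 <= y.
  move=> y0; have y1 : -1 < y - 1 by lra.
  have := le_ln1Dx y1; rewrite (_ : 1 + (y - 1) = y); last by ring.
  by lra.
split.
  have : c * s <= 2 / p * EK w * s.
    by apply: le_trans main _; rewrite ler_wpM2l// ln1.
  rewrite ler_pM2r// => H1.
  by rewrite ler_pdivrMr// -ler_pdivlMr// (le_trans H1)// le_eqVlt; apply/orP; left;
    apply/eqP; field; rewrite gt_eqF.
(* As [ln s = 2 * ln r], the root makes the right-hand side sublinear in [s], and a factor [r]
   cancels. *)
pose r := Num.sqrt s; have r0 : 0 < r by rewrite sqrtr_gt0.
have sE : s = r ^+ 2 by rewrite sqr_sqrtr// ltW.
rewrite NE ler_wpM2l ?(ltW c0)// sE.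
have lnr : ln s + 1 <= 2 * r.
  by rewrite sE lnXn// mulr2n; have := ln1 _ r0; lra.
have : c * r * r <= 4 / p * EK w * r.
  have -> : c * r * r = c * s by rewrite sE; ring.
  apply: le_trans main _; apply: le_trans (ler_wpM2l p20 lnr) _.
  by rewrite le_eqVlt; apply/orP; left; apply/eqP; ring.
rewrite ler_pM2r// => H1.
have rK : r <= 4 * EK w / (p * c).
  rewrite ler_pdivlMr ?mulr_gt0//.
  have -> : r * (p * c) = p * (c * r) by ring.
  have -> : 4 * EK w = p * (4 / p * EK w) by field; rewrite gt_eqF.
  by rewrite ler_pM2l.
by apply: lerXn2r => //; rewrite nnegrE ?(ltW r0)// (le_trans (ltW r0) rK).
Qed.

Local Notation nehari := (nehari e mu p a b).

(** * Existence of a ground state *)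

(** The indicator of one vertex, taken in both components, has positive [EK], so its ray meets the
    manifold. *)
Lemma nehari_nonempty (x0 : V) : exists w, nehari w.
Proof.
pose u x : R := if x == x0 then 1 else 0.
have u0 x : x != x0 -> u x = 0 by rewrite /u => /negbTE ->.
have fs (f : V -> R) : (forall x, x != x0 -> f x = 0) -> finite_set [set x | f x != 0].
  move=> f0; apply: (sub_finite_set _ (finite_set1 x0)) => x /=.
  by apply: contraNP => /eqP /f0 ->.
have l1 f : (forall x, x != x0 -> f x = 0) -> L1 f.
  by move=> f0; apply: L1_finite_support => //; exact: fs.
have wu : W1p e mu p u by apply: Cc_W1p => //; exact: fs.
have p0 : p != 0 by rewrite gt_eqF.
have A : adm (u, u).
  split; first split=> //=.
  - by apply: l1 => x xx0; rewrite u0// normr0 powR0// mulr0.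
  - by apply: l1 => x xx0; rewrite u0// normr0 powR0// mulr0.
  - by split; apply: l1 => x xx0; rewrite lcouplE/= u0// expr0n/= mul0r mulr0.
have lc : L1 (coupl u u).
  by apply: l1 => x xx0; rewrite couplE u0// expr0n/= mulr0.
have K0 : 0 < EK (u, u).
  have : 0 < Int (coupl u u).
    apply: lt_le_trans (point_le_Int mu_ge0 x0 lc (coupl_ge0 p u u)).
    by rewrite couplE /u eqxx normr1 powR1 expr1n !mul1r.
  by rewrite /EK/=; lra.
have [t _ [nt _]] := nehari_ray A K0.
by exists (scale t (u, u)).
Qed.

(** * The pointwise limit of a minimizing sequence *)

Section Limit.
Hypothesis a_fin : forall M, finite_set [set x | a x <= M].
Hypothesis b_fin : forall M, finite_set [set x | b x <= M].
Variables (w_ : nat -> (V -> R) * (V -> R)) (kappa B : R).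
Hypothesis w_nehari : forall i, nehari (w_ i).
Hypothesis EN_le : forall i, EN (w_ i) <= B.
Hypothesis EK_le : forall i, EK (w_ i) <= kappa + i.+1%:R^-1.
Variables (U : set_system nat) (u v : V -> R).
Context {UU : ProperFilter U}.
Hypothesis U_oo : \oo `<=` U.
Hypothesis cu : forall x, (w_ i).1 x @[i --> U] --> u x.
Hypothesis cv : forall x, (w_ i).2 x @[i --> U] --> v x.

Lemma nehari_adm w : nehari w -> adm w.
Proof. by move=> /nehariP[]. Qed.

Lemma EN_parts w : adm w -> [/\ L1 (densH a w.1), L1 (densH b w.2),
  0 <= Int (densH a w.1) & 0 <= Int (densH b w.2)].
Proof.
move=> [[wu wv lu lv] _]; split; [exact: L1_densH|exact: L1_densH|..];
  by apply: Int_ge0 => // x; exact: densH_ge0.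
Qed.

Lemma densH_limit (c f : V -> R) (f_ : nat -> V -> R) :
  (forall x, V0 <= c x) -> (forall M, finite_set [set x | c x <= M]) ->
  (forall x, f_ i x @[i --> U] --> f x) ->
  (forall i, W1p e mu p (f_ i)) ->
  (forall i, L1 (densH c (f_ i))) -> (forall i, Int (densH c (f_ i)) <= B) ->
  [/\ W1p e mu p f, L1 (densH c f), Int (densH c f) <= B &
      L1 (fun x => c x * `|f x| `^ p)].
Proof.
move=> cge cfin cf wf lf fB; have c0 x : 0 <= c x by rewrite (le_trans _ (cge x))// ltW.
have [lH IH] : L1 (densH c f) /\ Int (densH c f) <= B.
  apply: (@Fatou _ _ mu mu_ge0 _ U _ (fun i => densH c (f_ i)) _ (fun=> B)) => //.
  - by move=> i x; exact: densH_ge0.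
  - by move=> x; exact: cvg_densH.
  - exact: cvg_cst.
split=> //; last first.
  apply: L1_le lH => // x; rewrite ger0_norm ?mulr_ge0 ?powR_ge0//.
  by rewrite !densHE lerDr powR_ge0.
(* Since [1 <= V0^-1 * c x], the density [densW] is at most [C] times [densH c]; the finite sublevel
   sets of [c] provide the exhaustion for [W1p_limit]. *)
pose C := 1 + V0^-1.
have C0 : 0 < C by rewrite addr_gt0// invr_gt0.
apply: (@W1p_limit _ _ e mu p e_sym e_lf mu_gt0 p_gt2 mu_min nat U _ f_ f (C * B)
  (fun n => [set x | c x <= n%:R])) => //.
- by move=> n k nk x /= /le_trans; apply; rewrite ler_nat.
- move=> x; exists (Num.truncn (c x)).+1 => /=; apply: ltW; exact: truncnS_gt.
move=> i; apply: le_trans (_ : C * Int (densH c (f_ i)) <= _); last first.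
  by rewrite ler_wpM2l// ltW.
rewrite -IntZ//; apply: le_Int => //; [exact: W1p_L1|exact: L1Z|].
move=> x; rewrite densWE !densHE /C mulrDl mul1r.
have : `|f_ i x| `^ p <= V0^-1 * (c x * `|f_ i x| `^ p).
  by rewrite mulrA ler_peMl ?powR_ge0// mulrC ler_pdivlMr// mul1r.
have : 0 <= c x * `|f_ i x| `^ p by rewrite mulr_ge0 ?powR_ge0.
have : 0 <= V0^-1 * gradn e mu (f_ i) x `^ p.
  by rewrite mulr_ge0 ?powR_ge0 ?invr_ge0// ltW.
by rewrite mulrDr; lra.
Qed.

Lemma limit_spec :
  [/\ adm (u, v), 0 < EK (u, v), EK (u, v) <= kappa &
      EN (u, v) - EL (u, v) - 2 / p * EK (u, v) <= 0].
Proof.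
have aw i := nehari_adm (w_nehari i).
have NP i := EN_parts (aw i).
have [wu lHu IHu lu] : [/\ W1p e mu p u, L1 (densH a u), Int (densH a u) <= B &
      L1 (fun x => a x * `|u x| `^ p)].
  apply: (@densH_limit a u (fun i => (w_ i).1) a_ge a_fin cu) => i.
  - have [[w1 _ _ _] _] := aw i; exact: w1.
  - have [l1 _ _ _] := NP i; exact: l1.
  - by have [_ _ N1 N2] := NP i; apply: le_trans (EN_le i); rewrite /EN lerDl.
have [wv lHv IHv lv] : [/\ W1p e mu p v, L1 (densH b v), Int (densH b v) <= B &
      L1 (fun x => b x * `|v x| `^ p)].
  apply: (@densH_limit b v (fun i => (w_ i).2) b_ge b_fin cv) => i.
  - have [[_ w2 _ _] _] := aw i; exact: w2.
  - have [_ l2 _ _] := NP i; exact: l2.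
  - by have [_ _ N1 N2] := NP i; apply: le_trans (EN_le i); rewrite /EN lerDr.
have cuv := L1_coupl wu wv.
have cvu := L1_coupl wv wu.
pose g_ i x := `|(w_ i).1 x| `^ p + `|(w_ i).2 x| `^ p.
pose g x := `|u x| `^ p + `|v x| `^ p.
(* This is the weight for the reverse Fatou lemma: its sublevel sets are finite, and the integrals
   of [omega * g_ i] are bounded by [EN (w_ i)]. *)
pose omega x := Num.min (a x) (b x).
have om0 x : 0 <= omega x by rewrite le_min a0 b0.
have om_fin M : finite_set [set x | omega x <= M].
  apply: (@sub_finite_set _ _ ([set x | a x <= M] `|` [set x | b x <= M])).
    by move=> x /=; rewrite ge_min => /orP.
  by rewrite finite_setU.
have g0 i x : 0 <= g_ i x by rewrite addr_ge0 ?powR_ge0.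
have cg x : g_ i x @[i --> U] --> g x by apply: cvgD; exact: cvg_norm_powR.
have om_le i x : omega x * g_ i x <= densH a (w_ i).1 x + densH b (w_ i).2 x.
  rewrite mulrDr; apply: lerD; rewrite !densHE.
    by apply: ler_wpDl; rewrite ?powR_ge0// ler_wpM2r ?powR_ge0// ge_min lexx.
  by apply: ler_wpDl; rewrite ?powR_ge0// ler_wpM2r ?powR_ge0// ge_min lexx orbT.
have lH i : L1 (fun x => densH a (w_ i).1 x + densH b (w_ i).2 x).
  by have [l1 l2 _ _] := NP i; exact: (L1D mu_ge0 l1 l2).
have lom i : L1 (fun x => omega x * g_ i x).
  by apply: L1_le (lH i) => // x; rewrite ger0_norm ?mulr_ge0.
have Iom i : Int (fun x => omega x * g_ i x) <= B.
  apply: le_trans (EN_le i); have [l1 l2 _ _] := NP i.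
  by rewrite /EN -(IntD mu_ge0 l1 l2); exact: (le_Int mu_ge0 (lom i) (lH i)).
have rF (f_ : nat -> V -> R) f gam C : 0 <= C -> (forall i, L1 (f_ i)) ->
    (forall i x, f_ i x <= C * g_ i x) -> (forall x, f_ i x @[i --> U] --> f x) ->
    (forall i, gam <= Int (f_ i)) -> L1 f /\ gam <= Int f.
  move=> C0 lf fg cf gf.
  apply: (reverse_Fatou mu_ge0 om0 om_fin C0 g0 lom Iom lf fg cf cg gf).
  exact: cvg_cst.
pose k_ i x := coupl (w_ i).1 (w_ i).2 x + coupl (w_ i).2 (w_ i).1 x.
pose k x := coupl u v x + coupl v u x.
have lk12 i : L1 (coupl (w_ i).1 (w_ i).2) /\ L1 (coupl (w_ i).2 (w_ i).1).
  by have [[w1 w2 _ _] _] := aw i; split; exact: L1_coupl.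
have lk_ i : L1 (k_ i) := L1D mu_ge0 (lk12 i).1 (lk12 i).2.
have lk : L1 k := L1D mu_ge0 cuv cvu.
have k0 i x : 0 <= k_ i x by rewrite addr_ge0 ?coupl_ge0.
have k_le i x : k_ i x <= 2 * g_ i x.
  have := coupl_le p_gt4 (w_ i).1 (w_ i).2 x.
  by have := coupl_le p_gt4 (w_ i).2 (w_ i).1 x; rewrite /k_ /g_; lra.
have ck x : k_ i x @[i --> U] --> k x by apply: cvgD; exact: cvg_coupl.
have EKE : EK (u, v) = Int k by rewrite /EK /k /= (IntD mu_ge0 cuv cvu).
have EKE_ i : EK (w_ i) = Int (k_ i).
  by rewrite /EK /k_ /= (IntD mu_ge0 (lk12 i).1 (lk12 i).2).
(* No mass of [EK] escapes in the limit, which is therefore not the zero pair. *)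
have [_ Klow] : L1 k /\ V0 * mu_min * p / 2 <= Int k.
  apply: (rF k_ k _ 2) => // i; rewrite -EKE_.
  by have [] := nehari_bounds (w_nehari i).
have [_ Khigh] : L1 k /\ Int k <= kappa.
  apply: (@Fatou _ _ mu mu_ge0 _ U _ k_ k (fun i => kappa + i.+1%:R^-1)) => //.
    by move=> i; rewrite -EKE_.
  rewrite -[X in _ --> X]addr0; apply: cvgD; first exact: cvg_cst.
  (* [U] refines the filter at infinity, so the excess over [kappa] tends to 0. *)
  exact: (cvg_trans (cvg_app _ U_oo) cvg_harmonic).
have K0 : 0 < EK (u, v).
  by rewrite EKE (lt_le_trans _ Klow)// !mulr_gt0 ?invr_gt0.
pose l_ i x := lcoupl (w_ i).1 (w_ i).2 x + lcoupl (w_ i).2 (w_ i).1 x.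
pose l x := lcoupl u v x + lcoupl v u x.
pose h_ i x := densH a (w_ i).1 x + densH b (w_ i).2 x.
pose h x := densH a u x + densH b v x.
pose s := B / (V0 * mu_min).
have ll_ i : L1 (l_ i) by have [_ [l1 l2]] := aw i; exact: (L1D mu_ge0 l1 l2).
have lh : L1 h := L1D mu_ge0 lHu lHv.
have l_le i x : l_ i x <= 2 / p * ln s * k_ i x.
  have ws : `|(w_ i).1 x| `^ p <= s /\ `|(w_ i).2 x| `^ p <= s.
    have [w1 w2] := norm_powR_le_EN x (aw i).
    have Ns : EN (w_ i) / (V0 * mu_min) <= s.
      by rewrite ler_pM2r ?invr_gt0 ?mulr_gt0.
    by split; [exact: le_trans w1 Ns|exact: le_trans w2 Ns].
  by rewrite /l_ /k_ mulrDr; apply: lerD; [exact: lcoupl_le ws.2|exact: lcoupl_le ws.1].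
(* On the manifold this combination has integral 0 and is dominated by a multiple of [g_ i]. Keeping
   [h] inside gives the sign in the limit and the summability of [l] together. *)
have [lf If] : L1 (fun x => l x + 2 / p * k x - h x) /\
    0 <= Int (fun x => l x + 2 / p * k x - h x).
  (* The outer 2 comes from [k_ i <= 2 * g_ i]; the absolute value is there because [ln s] may be
     negative, and [+ 1] accounts for [2 / p * k_ i]. *)
  apply: (rF (fun i x => l_ i x + 2 / p * k_ i x - h_ i x) _ _
    (2 * (2 / p * (`|ln s| + 1)))).
  - by rewrite !mulr_ge0 ?invr_ge0 ?addr_ge0// ltW.
  - by move=> i; exact: (L1B mu_ge0 (L1D mu_ge0 (ll_ i) (L1Z mu_ge0 _ (lk_ i))) (lH i)).
  - move=> i x; apply: (@le_trans _ _ (2 / p * (`|ln s| + 1) * k_ i x)).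
      have : 0 <= h_ i x by rewrite addr_ge0// densH_ge0.
      have : 2 / p * ln s * k_ i x <= 2 / p * `|ln s| * k_ i x.
        rewrite ler_wpM2r// ler_wpM2l ?ler_norm// divr_ge0// ltW//.
      have := l_le i x.
      move: (l_ i x) (k_ i x) (h_ i x) => lx kx hx.
      have -> : 2 / p * (`|ln s| + 1) * kx = 2 / p * `|ln s| * kx + 2 / p * kx by ring.
      by lra.
    have -> : 2 * (2 / p * (`|ln s| + 1)) * g_ i x = 2 / p * (`|ln s| + 1) * (2 * g_ i x).
      by move: (g_ i x) => gx; ring.
    apply: ler_wpM2l; last exact: k_le.
    by rewrite !mulr_ge0 ?invr_ge0 ?addr_ge0// ltW.
  - move=> x; apply: cvgB.
      apply: cvgD; first by apply: cvgD; exact: cvg_lcoupl.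
      by apply: cvgMl_tmp; exact: ck.
    by apply: cvgD; exact: cvg_densH.
  - move=> i; have [l1 l2 _ _] := NP i; have [_ [l3 l4]] := aw i.
    have /nehariP[_ _ Ni] := w_nehari i.
    rewrite (IntB mu_ge0 (L1D mu_ge0 (ll_ i) (L1Z mu_ge0 _ (lk_ i))) (lH i)).
    rewrite (IntD mu_ge0 (ll_ i) (L1Z mu_ge0 _ (lk_ i))) (IntZ mu_ge0 _ (lk_ i)) -EKE_.
    rewrite (IntD mu_ge0 l1 l2) (IntD mu_ge0 l3 l4).
    rewrite -[X in _ - X]/(EN (w_ i)) -[X in X + _ - _]/(EL (w_ i)).
    by move: Ni; move: (EN _) (EL _) (2 / p * EK _) => ? ? ?; lra.
have ll : L1 l.
  apply: (@L1_ext _ _ mu (fun x => l x + 2 / p * k x - h x + h x - 2 / p * k x)).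
    by move=> x; ring.
  exact: (L1B mu_ge0 (L1D mu_ge0 lf lh) (L1Z mu_ge0 _ lk)).
(* Only the sum [l] is known to be summable, but each summand is bounded above by a summable
   function, hence also below by [l] minus the bound of the other. *)
have part (f1 f2 : V -> R) : (forall x, l x = lcoupl f1 f2 x + lcoupl f2 f1 x) ->
    W1p e mu p f1 -> W1p e mu p f2 -> L1 (lcoupl f1 f2).
  move=> lE w1 w2; have [g1 lg1 [_ g1P]] := lcoupl_L1_above w1 w2.
  have [g2 lg2 [_ g2P]] := lcoupl_L1_above w2 w1.
  apply: (L1_between (L1B mu_ge0 ll lg2) lg1) => x.
  by rewrite g1P andbT lE; have := g2P x; lra.
have luv : L1 (lcoupl u v) by exact: part.
have lvu : L1 (lcoupl v u) by apply: part => // x; rewrite /l addrC.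
split; [exact: conj (And4 wu wv lu lv) (conj luv lvu)|exact: K0|by rewrite EKE|].
move: If; rewrite (IntB mu_ge0 (L1D mu_ge0 ll (L1Z mu_ge0 _ lk)) lh).
rewrite (IntD mu_ge0 ll (L1Z mu_ge0 _ lk)) (IntZ mu_ge0 _ lk) -EKE.
rewrite (IntD mu_ge0 luv lvu) (IntD mu_ge0 lHu lHv).
rewrite -[X in _ - X]/(EN (u, v)) -[X in X + _ - _]/(EL (u, v)).
by move: (EN _) (EL _) (2 / p * EK _) => ? ? ?; lra.
Qed.

End Limit.
Lemma exists_ground_state (x0 : V) :
  (forall M, finite_set [set x | a x <= M]) ->
  (forall M, finite_set [set x | b x <= M]) ->
  exists w, ground_state e mu p a b w.
Proof.
move=> a_fin b_fin; pose S := [set EK w | w in nehari].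
have S_lb : lbound S 0 by move=> _ [w _ <-]; exact: EK_ge0.
have S_ne : S !=set0 by have [w nw] := nehari_nonempty x0; exists (EK w), w.
pose kappa := inf S.
have /choice[w_ w_P] i : exists w, nehari w /\ EK w <= kappa + i.+1%:R^-1.
  have [||_ [w nw <-] /ltW Kw] := @inf_adherent _ S i.+1%:R^-1.
  - by rewrite invr_gt0.
  - by split=> //; exists 0.
  - by exists w.
have w_nehari i := (w_P i).1; have EK_le i := (w_P i).2.
pose c := V0 * mu_min; have c0 : 0 < c by exact: mulr_gt0.
have pc0 : 0 < p * c by rewrite mulr_gt0.
(* This is the bound of [nehari_bounds] evaluated at [kappa + 1], which dominates every
   [EK (w_ i)]. *)
pose B := c * (4 * (kappa + 1) / (p * c)) ^+ 2.
have EN_le i : EN (w_ i) <= B.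
  have [_ NK] := nehari_bounds (w_nehari i); apply: le_trans NK _.
  have K_le : EK (w_ i) <= kappa + 1.
    by apply: le_trans (EK_le i) _; rewrite lerD2l invf_le1 ?ler1n.
  have K_ge := EK_ge0 (w_ i).
  have le4 : 4 * EK (w_ i) / (p * c) <= 4 * (kappa + 1) / (p * c).
    by rewrite ler_pM2r ?invr_gt0// ler_pM2l.
  have ge4 : 0 <= 4 * EK (w_ i) / (p * c).
    by rewrite mulr_ge0 ?invr_ge0 ?(ltW pc0)// mulr_ge0.
  rewrite /B ler_wpM2l ?(ltW c0)//; apply: lerXn2r => //; rewrite nnegrE//.
  exact: le_trans ge4 le4.
have [U [UU U_oo]] := ultraFilterLemma (eventually_filter).
have bounded (f : nat -> R) : (forall i, `|f i| `^ p <= B / c) ->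
    exists l : R, f i @[i --> U] --> l.
  move=> fB; apply: (ultra_bounded_cvg (M := (B / c) `^ p^-1)) => i.
  have -> : `|f i| = (`|f i| `^ p) `^ p^-1.
    by rewrite -powRrM mulfV ?gt_eqF// powRr1.
  have Bc := le_trans (powR_ge0 _ _) (fB i).
  by apply: ge0_ler_powR; rewrite ?nnegrE ?powR_ge0 ?invr_ge0 ?(ltW p_gt0).
have w_le i x : `|(w_ i).1 x| `^ p <= B / c /\ `|(w_ i).2 x| `^ p <= B / c.
  have /nehariP[A _ _] := w_nehari i; have [w1 w2] := norm_powR_le_EN x A.
  have Ns : EN (w_ i) / c <= B / c by rewrite ler_pM2r ?invr_gt0.
  by split; [exact: le_trans w1 Ns|exact: le_trans w2 Ns].
have /choice[u cu] x : exists l : R, (w_ i).1 x @[i --> U] --> l.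
  by apply: bounded => i; exact: (w_le i x).1.
have /choice[v cv] x : exists l : R, (w_ i).2 x @[i --> U] --> l.
  by apply: bounded => i; exact: (w_le i x).2.
have [A K0 Kk N0] := limit_spec a_fin b_fin w_nehari EN_le EK_le U_oo cu cv.
have [t t0 [nt t1]] := nehari_ray A K0.
exists (scale t (u, v)); split=> //.
have [_ _ EKt _] := adm_scale t0 A.
have tp1 : t `^ p <= 1.
  rewrite (_ : 1 = 1 `^ p); last by rewrite powR1.
  by apply: ge0_ler_powR; rewrite ?nnegrE ?(ltW p_gt0) ?(ltW t0)//; exact: t1.
apply/eqP; rewrite eq_le; apply/andP; split; last first.
  by apply: ereal_inf_lbound; exists (scale t (u, v)).
(* On the manifold [J] is a fixed multiple of [EK]; as [t <= 1], rescaling the limit does not raise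
   [EK] above [kappa]. *)
apply/ereal_infP => _ [w nw <-]; rewrite !J_nehari// lee_fin.
rewrite ler_wpM2l ?divr_ge0 ?exprn_ge0 ?(ltW p_gt0)// EKt.
apply: le_trans (_ : EK (u, v) <= _); first by rewrite ger_pMl.
by apply: le_trans Kk _; apply: ge_inf; [exists 0|exists w].
Qed.

End Energy.

Theorem theorem1p1 (R : realType) (V : choiceType) (e : rel V)
    (mu : V -> R) (mu_min : R) (a b : V -> R) (V0 : R)
    (e_sym : symmetric e)
    (e_connected : connected_graph e)
    (e_locally_finite : locally_finite e)
    (mu_min_gt0 : 0 < mu_min)
    (mu_ge : forall x, mu_min <= mu x)
    (V0_gt0 : 0 < V0)
    (A1 : forall x, V0 <= a x /\ V0 <= b x)
    (A2 : forall M : R, 0 < M ->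
       (volume mu [set x | (a x <= M)%R] < +oo)%E /\
       (volume mu [set x | (b x <= M)%R] < +oo)%E) :
  forall p : R, 4 < p ->
    exists u0 v0 : V -> R, ground_state e mu p a b (u0, v0).
Proof.
move=> p p4; have [[x0 _] _] := e_connected.
have fin (c : V -> R) :
    (forall M, 0 < M -> (volume mu [set x | (c x <= M)%R] < +oo)%E) ->
    forall M, finite_set [set x | c x <= M].
  (* (A2) speaks of positive levels only, hence the passage from [M] to [|M| + 1]. *)
  move=> cvol M; apply: (@sub_finite_set _ _ [set x | c x <= `|M| + 1]).
    by move=> x /= cM; rewrite (le_trans cM)// (le_trans (ler_norm M))// lerDl.
  by apply: (finite_volume_finite mu_min_gt0 mu_ge); apply: cvol; rewrite ltr_wpDl.
have [||[u v] uv] := exists_ground_state e_sym e_locally_finite mu_min_gt0 mu_ge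
  V0_gt0 (fun x => (A1 x).1) (fun x => (A1 x).2) p4 x0.
- by apply: fin => M M0; exact: (A2 M M0).1.
- by apply: fin => M M0; exact: (A2 M M0).2.
- by exists u, v.
Qed.
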